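(* Consider the standard stochastic blockmodel on $n$ nodes: the nodes are partitioned into $r$ clusters each of size exactly $K$ (no outliers), and edges between distinct pairs are drawn independently with probability exactly $p$ within clusters and exactly $q$ across clusters, $p>q$. Let $A$ be the adjacency matrix (with $a_{ii}=1$). Run the following procedure: (1) compute the eigenvalues of $A$ sorted as $\hat\lambda_1>\hat\lambda_2>\dots>\hat\lambda_n$; (2) set $\hat r=\arg\max_{i=2,\dots,n-1}(\hat\lambda_i-\hat\lambda_{i+1})$ and $\hat K=n/\hat r$; (3) set $$\hat p=\frac{\hat K\hat\lambda_1+(n-\hat K)\hat\lambda_2-n}{n(\hat K-1)},\qquad \hat q=\frac{\hat\lambda_1-\hat\lambda_2}{n};$$ (4) set $t=(\hat p+\hat q)/2$. Suppose $$\frac{p-q}{\sqrt{p(1-q)}}\ \ge\ c_1\max\left\{\frac{\sqrt{n}}{K},\ \frac{\log^2 n}{\sqrt{K}}\right\}$$ where $c_1$ is an absolute constant. Then with high probability, for an absolute constant $c_4>0$, $$\hat K=K,\qquad \max\{|\hat p-p|,|\hat q-q|\}\le c_4\frac{\sqrt{p(1-q)n}}{K},\qquad \tfrac14 p+\tfrac34 q\le t\le \tfrac34 p+\tfrac14 q.$$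
   Context: ''With high probability'' means with probability at least $1-c_0n^{-8}$ for a universal constant $c_0$. $c_1$ is the (suitably large) absolute constant appearing in the paper's main recovery condition.
   Formalization: The number of clusters is assumed to be at least 2: for r = 1 (K = n) the claim is false, since the procedure only searches for r-hat among 2,...,n-1 and so K-hat is at most n/2, never equal to K. *)

(* Defs.v *)
From HB Require Import structures.
From mathcomp Require Import all_boot all_order all_algebra.
From mathcomp Require Import all_classical all_reals all_analysis.
Set Implicit Arguments. Unset Strict Implicit. Unset Printing Implicit Defensive.
Import Order.TTheory GRing.Theory Num.Theory.
Local Open Scope ring_scope.

Section SBM.
Variable R : realType.
Variables n r : nat.

(* A sample: x i j for i < j is the indicator of the edge {i,j};
   entries with i >= j carry no information and are forced to false. *)
Definition sample := {ffun 'I_n -> {ffun 'I_n -> bool}}.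

Definition edge_prob (sigma : 'I_n -> 'I_r) (p q : R) (i j : 'I_n) : R :=
  if sigma i == sigma j then p else q.

Definition sbm_weight (sigma : 'I_n -> 'I_r) (p q : R) (x : sample) : R :=
  \prod_(i : 'I_n) \prod_(j : 'I_n)
    (if (i < j)%N then (if x i j then edge_prob sigma p q i j
                        else 1 - edge_prob sigma p q i j)
     else (if x i j then 0 else 1)).

Definition sbm_P (sigma : 'I_n -> 'I_r) (p q : R) (E : sample -> Prop) : R :=
  \sum_(x : sample | `[< E x >]) sbm_weight sigma p q x.

Definition adj (x : sample) : 'M[R]_n :=
  \matrix_(i, j) (if i == j then 1
                  else if (i < j)%N then (x i j)%:R else (x j i)%:R).

Definition sorted_spectrum (A : 'M[R]_n) (s : seq R) : Prop :=
  [/\ size s = n, sorted (fun a b => b <= a) s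
    & char_poly A = \prod_(l <- s) ('X - l%:P)].

(* 1-indexed eigenvalue lambda_i. *)
Definition eig (s : seq R) (i : nat) : R := nth 0 s i.-1.
Definition gap (s : seq R) (i : nat) : R := eig s i - eig s i.+1.

Definition Khat (rh : nat) : R := n%:R / rh%:R.
Definition phat (s : seq R) (rh : nat) : R :=
  (Khat rh * eig s 1 + (n%:R - Khat rh) * eig s 2 - n%:R)
  / (n%:R * (Khat rh - 1)).
Definition qhat (s : seq R) : R := (eig s 1 - eig s 2) / n%:R.
Definition thresh (s : seq R) (rh : nat) : R := (phat s rh + qhat s) / 2.

Definition success (c4 : R) (K : nat) (p q : R) (x : sample) : Prop :=
  forall s, sorted_spectrum (adj x) s ->
  forall rh : nat, (2 <= rh <= n.-1)%N ->
    (forall i : nat, (2 <= i <= n.-1)%N -> gap s i <= gap s rh) ->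
    [/\ Khat rh = K%:R,
        Num.max `|phat s rh - p| `|qhat s - q|
          <= c4 * Num.sqrt (p * (1 - q) * n%:R) / K%:R
      & p / 4 + 3 * q / 4 <= thresh s rh <= 3 * p / 4 + q / 4].

End SBM.

(* Main.v *)
Require Import Defs.
From HB Require Import structures.
From mathcomp Require Import all_boot all_order all_algebra.
From mathcomp Require Import all_classical all_reals all_analysis.
From mathcomp Require Import complex spectral ring lra zify.
Import Order.TTheory GRing.Theory Num.Theory.
Local Open Scope ring_scope.
Set Implicit Arguments. Unset Strict Implicit. Unset Printing Implicit Defensive.

(* Everything rests on a bound |x W x^T| <= delta |x|^2 for W = A - E A with
   delta of order sqrt(p (1 - q) n). Given it, Courant-Fischer with explicit test
   spaces (the all-one vector, the span of the cluster indicators and their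
   orthogonal complements) places lambda_1, lambda_2..lambda_r and the other
   eigenvalues within delta of q n + K (p - q) + 1 - p, K (p - q) + 1 - p and
   1 - p; the largest gap is then at r and the estimates follow.

   The bound on W comes from the trace method with a comparison argument in the
   style of Bandeira and van Handel. Put k ~ p (1 - q) n and expand
   E tr W^(2k) over closed walks. Only walks using each edge at least twice
   contribute, each at most (k/n)^(v-1) where v is its number of vertices. Up to
   the factor n/k, the resulting sum is at most the number of such walks on only
   m = 3k vertices, hence at most E tr Y^(2k) for a dense m x m matrix Y with
   independent centered entries in {2, -1}, all of whose higher moments are at
   least 1. As the power 2k is comparable to the dimension m, a union bound over
   a net of lattice vectors suffices to show E tr Y^(2k) <= C m (D k)^k. Markov's
   inequality then gives failure probability O(n exp(-k)), and the recovery
   condition forces k >= 9 ln n. *)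

(** * Courant-Fischer inequalities for real symmetric matrices *)

Definition qf {R : pzRingType} {n : nat} (A : 'M[R]_n) (x : 'rV[R]_n) : R :=
  (x *m A *m x^T) 0 0.

Lemma char_poly_conj (F : fieldType) n (P D : 'M[F]_n) :
  P \in unitmx -> char_poly (invmx P *m D *m P) = char_poly D.
Proof.
move=> uP; rewrite /char_poly /char_poly_mx.
set M := 'X%:M - map_mx _ D.
suff -> : 'X%:M - map_mx polyC (invmx P *m D *m P) =
   map_mx polyC (invmx P) *m M *m map_mx polyC P.
  by rewrite !det_mulmx mulrAC -det_mulmx -map_mxM mulVmx // map_mx1 det1 mul1r.
rewrite /M mulmxBr mulmxBl !map_mxM; congr (_ - _).
by rewrite scalar_mxC -mulmxA -map_mxM mulVmx // map_mx1 mulmx1.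
Qed.

Section Spectral.
Variable R : realType.
Local Notation C := R[i].
Local Notation toC := (@real_complex R).

Lemma conjC_toC (x : R) : (toC x)^* = toC x.
Proof. by rewrite -[RHS](conjc_real x). Qed.

(** [A] is Hermitian over [R[i]], hence unitarily diagonalizable with real diagonal; unique
    factorization of the characteristic polynomial identifies that diagonal with [s] up to order. *)
Lemma real_spectral n (A : 'M[R]_n) (s : seq R) :
  A^T = A -> char_poly A = \prod_(l <- s) ('X - l%:P) ->
  exists (P : 'M[C]_n) (d : 'I_n -> R),
    [/\ P *m (map_mx Num.conj P)^T = 1%:M,
        map_mx toC A =
          (map_mx Num.conj P)^T *m diag_mx (\row_j toC (d j)) *m P
      & perm_eq s [seq d i | i <- enum 'I_n]].
Proof.
move=> symA chA; set B := map_mx toC A.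
have hB : B \is hermsymmx.
  apply: realsym_hermsym.
    by apply/is_hermitianmxP; rewrite expr0 scale1r map_mx_id // map_trmx symA.
  by apply/mxOverP => i j; rewrite mxE; apply/complex_realP; eexists.
have uP := spectral_unitarymx B; set P := spectralmx B in uP.
have eB : B = invmx P *m diag_mx (spectral_diag B) *m P.
  by apply/orthomx_spectralP/hermitian_normalmx.
have iP : invmx P = (map_mx Num.conj P)^T.
  by rewrite invmx_unitary // map_trmx.
have /mxOverP rD := hermitian_spectral_diag_real hB.
set D := spectral_diag B in eB rD.
have eD : D = \row_j toC (complex.Re (D 0 j)).
  by apply/rowP => j; rewrite mxE RRe_real.
exists P, (fun j => complex.Re (D 0 j)); split.
- by rewrite -iP mulmxV // spectral_unit.
- by rewrite -eD -iP.
have chB : char_poly B = \prod_(l <- [seq toC i | i <- s]) ('X - l%:P).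
  rewrite -map_char_poly chA rmorph_prod big_map; apply: eq_bigr => l _.
  by rewrite rmorphB /= map_polyX map_polyC.
suff : perm_eq [seq toC i | i <- s] [seq toC i | i <- [seq complex.Re (D 0 i) | i <- enum 'I_n]].
  move/(perm_map (@complex.Re R)); rewrite -!map_comp.
  by rewrite !(eq_map (_ : @complex.Re R \o toC =1 id)) // !map_id map_comp.
apply: prod_XsubC_eq; rewrite -chB eB char_poly_conj ?spectral_unit //.
rewrite char_poly_trig ?diag_mx_is_trig // 2!big_map big_enum.
by apply: eq_bigr => j _; rewrite !mxE eqxx mulr1n RRe_real.
Qed.


(** Dimension count: the kernel of [V *m M] has dimension at least [m - k], more than that of
    [kermx V]. *)
Lemma kermx_avoid (F : fieldType) m n k (V : 'M[F]_(m, n)) (M : 'M[F]_(n, k)) :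
  (k < \rank V)%N -> exists2 w : 'rV[F]_m, w *m V != 0 & w *m V *m M = 0.
Proof.
move=> ltk; have : ~~ (kermx (V *m M) <= kermx V)%MS.
  apply/negP => /mxrankS; rewrite !mxrank_ker.
  have := rank_leq_row V; have := rank_leq_col (V *m M); lia.
case/row_subPn => i; set w := row i _ => wV; exists w.
  by apply: contraNneq wV => w0; apply/sub_kermxP.
by rewrite -mulmxA; apply/sub_kermxP; rewrite row_sub.
Qed.

Lemma avoid_coords n m (P : 'M[C]_n) (V : 'M[C]_(m, n)) (T : {pred 'I_n}) :
  (#|T| < \rank V)%N ->
  exists2 w : 'rV[C]_m, w *m V != 0 &
    forall j, j \in T -> (w *m V *m P) 0 j = 0.
Proof.
move=> ltT; have [w w0 wM] := @kermx_avoid _ _ _ _ V (colsub (fun i : 'I_#|T| => enum_val i) P) ltT.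
exists w => // j jT.
have : (w *m V *m colsub (fun i : 'I_#|T| => enum_val i) P) 0 (enum_rank_in jT j) = 0.
  by rewrite wM mxE.
move=> <-; rewrite [LHS]mxE [RHS]mxE; apply: eq_bigr => i _.
by rewrite [colsub _ _ _ _]mxE enum_rankK_in.
Qed.

Local Notation herm M x := ((x *m M *m (map_mx Num.conj x)^T) 0 0).

(** The cross terms between real and imaginary parts cancel by symmetry of [A], so a complex test
    vector amounts to two real ones. *)
Lemma herm_real n (A : 'M[R]_n) (x : 'rV[C]_n) : A^T = A ->
  herm (map_mx toC A) x =
    toC (qf A (map_mx (@complex.Re R) x) + qf A (map_mx (@complex.Im R) x)).
Proof.
move=> sA; set u := map_mx _ x; set v := map_mx (@complex.Im R) x.
set i : C := Complex 0 1.
have ex : x = map_mx toC u + i *: map_mx toC v.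
  by apply/rowP => j; rewrite !mxE [LHS]complexE.
have ex' : map_mx Num.conj x = map_mx toC u - i *: map_mx toC v.
  apply/rowP => j; rewrite {1}ex !mxE rmorphD rmorphM /= !conjC_toC -mulNr.
  congr (_ + _ * _); rewrite /i -[LHS]/(Complex 0 (- 1)).
  by rewrite -[RHS]/(Complex (- 0) (- 1)) oppr0.
have ii : i * i = -1 by rewrite -expr2 sqr_i.
have vu : v *m A *m u^T = (u *m A *m v^T).
  have <- : (v *m A *m u^T)^T = u *m A *m v^T by rewrite !trmx_mul trmxK sA mulmxA.
  by apply/matrixP => a b; rewrite !ord1 [RHS]mxE.
have -> : (map_mx Num.conj x)^T = map_mx toC u^T - i *: map_mx toC v^T.
  by rewrite ex' linearB linearZ /= !map_trmx.
rewrite {1}ex !mulmxDl !mulmxBr -!scalemxAl -!scalemxAr.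
rewrite -!map_mxM vu scalerA ii scaleN1r opprK /qf rmorphD /=.
by rewrite addrA subrK mxE [X in X + _]mxE [X in _ + X]mxE.
Qed.

(** [N j] is the squared modulus of the [j]-th eigenbasis coordinate of a complex vector in the row
    space of [V], chosen without component along the eigenvectors in [T]; [x] and [y] give its real
    and imaginary parts. *)
Lemma spectral_test_vector n m (A : 'M[R]_n) (s : seq R) (V : 'M[R]_(m, n)) :
  A^T = A -> char_poly A = \prod_(l <- s) ('X - l%:P) ->
  exists2 d : 'I_n -> R, perm_eq s [seq d i | i <- enum 'I_n] &
    forall T : {pred 'I_n}, (#|T| < \rank V)%N ->
    exists (x y : 'rV[R]_m) (N : 'I_n -> R),
    [/\ (forall j, 0 <= N j), (forall j, j \in T -> N j = 0), 0 < \sum_j N j,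
       qf A (x *m V) + qf A (y *m V) = \sum_j d j * N j
     & qf 1%:M (x *m V) + qf 1%:M (y *m V) = \sum_j N j].
Proof.
move=> sA chA; have [P [d [PP eA ps]]] := real_spectral sA chA.
exists d => // T ltT; set VC := map_mx toC V; set P' := (map_mx Num.conj P)^T in PP eA.
have [|w w0 wT] := @avoid_coords n m P' VC T; first by rewrite /VC mxrank_map.
set z := w *m VC in w0 wT; set y := z *m P' in wT.
have P'P : P' *m P = 1%:M by apply: mulmx1C.
pose N j : R := complex.Re (y 0 j) ^+ 2 + complex.Im (y 0 j) ^+ 2.
have NE j : y 0 j * (y 0 j)^* = toC (N j) by rewrite -normCK add_Re2_Im2.
have N0 j : 0 <= N j by rewrite addr_ge0 ?sqr_ge0.
have yt : (map_mx Num.conj y)^T = P *m (map_mx Num.conj z)^T.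
  rewrite /y map_mxM trmx_mul; congr (_ *m _).
  by apply/matrixP => a b; rewrite /P' !mxE; exact: conjCK.
have hermE (e : 'I_n -> R) :
  herm (P' *m diag_mx (\row_j toC (e j)) *m P) z = toC (\sum_j e j * N j).
  rewrite !mulmxA -/y -(mulmxA _ P) -yt mxE rmorph_sum; apply: eq_bigr => j _ /=.
  rewrite mul_mx_diag !mxE mulrAC mulrC rmorphM /= -NE.
  by rewrite [y 0 j]mxE.
have sum_gt0 : 0 < \sum_j N j.
  rewrite lt_def sumr_ge0 // andbT; apply: contraNneq w0 => /eqP.
  rewrite psumr_eq0 // => /allP y0.
  suff y00 : y = 0 by rewrite -[z]mulmx1 -P'P mulmxA -/y y00 mul0mx.
  apply/rowP => j; rewrite [RHS]mxE; apply/eqP; rewrite -normr_eq0 -sqrf_eq0.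
  by rewrite normCK NE (eqP (y0 j _)) // mem_index_enum.
have e1 : 1%:M = P' *m diag_mx (\row_j toC 1) *m P.
  rewrite -[LHS]P'P; congr (_ *m _); rewrite -[LHS]mulmx1; congr (_ *m _).
  by apply/matrixP => a b; rewrite !mxE.
have Re_z : map_mx (@complex.Re R) z = map_mx (@complex.Re R) w *m V.
  apply/rowP => j; rewrite !mxE [complex.Re _](raddf_sum (@complex.Re R)).
  by apply: eq_bigr => k _; rewrite !mxE /=; case: (w 0 k) => a b /=; ring.
have Im_z : map_mx (@complex.Im R) z = map_mx (@complex.Im R) w *m V.
  apply/rowP => j; rewrite !mxE (raddf_sum (@complex.Im R)).
  by apply: eq_bigr => k _; rewrite !mxE /=; case: (w 0 k) => a b /=; ring.
exists (map_mx (@complex.Re R) w), (map_mx (@complex.Im R) w), N.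
split=> //.
- by move=> j /wT yj0; rewrite /N yj0 /= expr0n addr0.
- by rewrite -Re_z -Im_z; apply: complexI; rewrite -herm_real // eA hermE.
- rewrite -Re_z -Im_z; apply: complexI; rewrite -herm_real ?trmx1 // map_mx1.
  by rewrite e1 hermE; congr toC; apply: eq_bigr => j _; rewrite mul1r.
Qed.

End Spectral.

Section CourantFischer.
Variables (R : realType) (n : nat) (A : 'M[R]_n) (s : seq R).
Hypotheses (symA : A^T = A) (specA : sorted_spectrum A s).

Let size_s : size s = n. Proof. by case: specA. Qed.

Lemma spectrum_le i j : (i <= j)%N -> (j < n)%N -> s`_j <= s`_i.
Proof.
case: specA => _ srt _ lij ltj.
have ge_trans : transitive (fun a b : R => b <= a) by move=> a b c ab /le_trans; apply.
have ge_refl : reflexive (fun a b : R => b <= a) by move=> a /=.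
by apply: (sorted_leq_nth ge_trans ge_refl 0 srt) => //; rewrite inE size_s //; lia.
Qed.

Lemma card_perm_count (d : 'I_n -> R) (a : pred R) :
  perm_eq s [seq d i | i <- enum 'I_n] -> #|[pred j | a (d j)]| = count a s.
Proof.
move/permP => ->; rewrite count_map cardE size_filter /=.
by rewrite count_filter; apply: eq_count => j; rewrite /= andbT.
Qed.

(** If the eigenvalue of index [i] were below [c], at most [i] eigenvalues would reach [c]; the
    complexified row space of [V] would contain a nonzero vector orthogonal to their eigenvectors,
    on which the form is strictly below [c] times the squared norm. *)
Lemma courant_fischer_ge m (V : 'M[R]_(m, n)) i c :
  (i < n)%N -> (i < \rank V)%N ->
  (forall w : 'rV_m, c * qf 1%:M (w *m V) <= qf A (w *m V)) -> c <= s`_i.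
Proof.
move=> ltin ltiV Hc; rewrite leNgt; apply/negP => ltc.
have [_ _ chA] := specA.
have [d ps] := spectral_test_vector V symA chA.
case/(_ [pred j | c <= d j]).
  rewrite (card_perm_count (fun x => c <= x)) //; apply: leq_ltn_trans ltiV.
  rewrite -(cat_take_drop i s) count_cat [X in (_ + X)%N](_ : _ = 0%N).
    by rewrite addn0; apply: leq_trans (count_size _ _) _; rewrite size_take size_s ltin.
  apply/eqP; rewrite -leqn0 leqNgt -has_count; apply/hasPn => x.
  move=> /(nthP 0) [k]; rewrite size_drop size_s nth_drop => ltk <-.
  rewrite -ltNge; apply: le_lt_trans ltc; apply: spectrum_le; lia.
move=> x [y [N [N0 NT Ngt qA q1]]].
have : c * \sum_j N j <= \sum_j d j * N j.
  by rewrite -q1 -qA mulrDr lerD.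
apply/negP; rewrite -ltNge mulr_sumr -subr_gt0 -sumrB.
have t0 j : 0 <= c * N j - d j * N j.
  rewrite -mulrBl; case: (boolP (c <= d j)) => [/NT->|]; first by rewrite mulr0.
  by rewrite -ltNge => lt; rewrite mulr_ge0 // subr_ge0 ltW.
rewrite lt_def sumr_ge0 // andbT; apply: contraTneq Ngt => /eqP.
rewrite psumr_eq0 // => /allP al0; rewrite big1 ?ltxx // => j _.
have := al0 j (mem_index_enum _); rewrite /= -mulrBl mulf_eq0 subr_eq0.
case/orP => [/eqP cd|/eqP //]; apply: NT; by rewrite inE cd.
Qed.

(** Dual argument: if the bound failed, at most [n - i - 1] eigenvalues would be at most [c], and
    the rank of [V] suffices to avoid their eigenvectors. *)
Lemma courant_fischer_le m (V : 'M[R]_(m, n)) i c :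
  (i < n)%N -> (n - i <= \rank V)%N ->
  (forall w : 'rV_m, qf A (w *m V) <= c * qf 1%:M (w *m V)) -> s`_i <= c.
Proof.
move=> ltin leiV Hc; rewrite leNgt; apply/negP => ltc.
have [_ _ chA] := specA.
have [d ps] := spectral_test_vector V symA chA.
case/(_ [pred j | d j <= c]).
  rewrite (card_perm_count (fun x => x <= c)) //; apply: leq_trans leiV.
  rewrite -(cat_take_drop i.+1 s) count_cat [X in (X + _)%N](_ : _ = 0%N).
    by rewrite add0n; apply: leq_ltn_trans (count_size _ _) _; rewrite size_drop size_s; lia.
  apply/eqP; rewrite -leqn0 leqNgt -has_count; apply/hasPn => x.
  move=> /(nthP 0) [k]; rewrite size_take_min size_s => ltk <-.
  rewrite nth_take; last lia.
  rewrite -ltNge; apply: lt_le_trans ltc _; apply: spectrum_le; lia.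
move=> x [y [N [N0 NT Ngt qA q1]]].
have : \sum_j d j * N j <= c * \sum_j N j.
  by rewrite -q1 -qA mulrDr lerD.
apply/negP; rewrite -ltNge mulr_sumr -subr_gt0 -sumrB.
have t0 j : 0 <= d j * N j - c * N j.
  rewrite -mulrBl; case: (boolP (d j <= c)) => [/NT->|]; first by rewrite mulr0.
  by rewrite -ltNge => lt; rewrite mulr_ge0 // subr_ge0 ltW.
rewrite lt_def sumr_ge0 // andbT; apply: contraTneq Ngt => /eqP.
rewrite psumr_eq0 // => /allP al0; rewrite big1 ?ltxx // => j _.
have := al0 j (mem_index_enum _); rewrite /= -mulrBl mulf_eq0 subr_eq0.
case/orP => [/eqP cd|/eqP //]; apply: NT; by rewrite inE cd.
Qed.

End CourantFischer.

(** * Eigenvalues of the perturbed expected adjacency matrix *)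

Section QuadraticForm.
Variable R : realFieldType.

Lemma qfD n (A B : 'M[R]_n) x : qf (A + B) x = qf A x + qf B x.
Proof. by rewrite /qf mulmxDr mulmxDl mxE. Qed.

Lemma qfZ n c (A : 'M[R]_n) x : qf (c *: A) x = c * qf A x.
Proof. by rewrite /qf -scalemxAr -scalemxAl mxE. Qed.

Lemma qf0 n (A : 'M[R]_n) : qf A 0 = 0.
Proof. by rewrite /qf !mul0mx mxE. Qed.

Lemma qfN n (A : 'M[R]_n) x : qf (- A) x = - qf A x.
Proof. by rewrite /qf mulmxN mulNmx mxE. Qed.

Lemma qf1E n (x : 'rV[R]_n) : qf 1%:M x = \sum_i x 0 i ^+ 2.
Proof. by rewrite /qf mulmx1 mxE; apply: eq_bigr => i _; rewrite mxE expr2. Qed.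

Lemma qf1_ge0 n (x : 'rV[R]_n) : 0 <= qf 1%:M x.
Proof. by rewrite qf1E sumr_ge0 // => i _; rewrite sqr_ge0. Qed.

Lemma qf1Z n c (x : 'rV[R]_n) : qf 1%:M (c *: x) = c ^+ 2 * qf 1%:M x.
Proof. by rewrite !qf1E mulr_sumr; apply: eq_bigr => i _; rewrite mxE exprMn. Qed.

Lemma qf_gram m n (M : 'M[R]_(m, n)) x : qf (M^T *m M) x = qf 1%:M (x *m M^T).
Proof. by rewrite /qf mulmx1 trmx_mul trmxK !mulmxA. Qed.

Lemma qf_tight m n (M : 'M[R]_(m, n)) c (w : 'rV_m) :
  M *m M^T = c%:M -> qf 1%:M (w *m M) = c * qf 1%:M w.
Proof.
move=> MM; rewrite /qf !mulmx1 trmx_mul mulmxA -(mulmxA w) MM mul_mx_scalar.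
by rewrite -scalemxAl mxE.
Qed.

Lemma rank_tight m n (M : 'M[R]_(m, n)) c :
  c != 0 -> M *m M^T = c%:M -> \rank M = m.
Proof.
move=> c0 MM; apply/eqP; rewrite eqn_leq rank_leq_row.
have : \rank (M *m M^T) = m by rewrite MM -scalemx1 mxrank_scale_nz // mxrank1.
by move=> {1}<-; rewrite mxrankM_maxl.
Qed.

(* [M^T M / c] is an orthogonal projection. *)
Lemma bessel_tight m n (M : 'M[R]_(m, n)) c (x : 'rV_n) :
  0 < c -> M *m M^T = c%:M -> qf 1%:M (x *m M^T) <= c * qf 1%:M x.
Proof.
move=> c0 MM; set y := x *m M^T.
have := qf1_ge0 (c *: x - y *m M).
have -> : qf 1%:M (c *: x - y *m M) = c * (c * qf 1%:M x - qf 1%:M y).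
  rewrite {1}/qf mulmx1 linearB linearZ /= trmx_mul !mulmxBl !mulmxBr.
  rewrite -!scalemxAl -!scalemxAr -!mulmxA (mulmxA M) MM mul_scalar_mx.
  rewrite !mulmxA -/y -!scalemxAr.
  have -> : y *m M *m x^T = y *m y^T by rewrite -mulmxA /y !trmx_mul trmxK.
  by rewrite !mxE /qf !mulmx1 !mxE; ring.
by rewrite pmulr_rge0 // subr_ge0.
Qed.

End QuadraticForm.

(** [a - b] is the gap across two levels [u] and [v], at least [u - v - 2 d], whereas [c - e] is a
    gap inside one level [f], at most [2 d]; this excludes every maximizer but the true index. *)
Lemma separation_contra (R : realFieldType) (u v d a b c e f : R) :
  0 < u - v -> 8 * d <= u - v -> `|a - u| <= d -> `|b - v| <= d ->
  `|c - f| <= d -> `|e - f| <= d -> a - b <= c - e -> False.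
Proof. by rewrite !ler_distl => ? ? /andP[? ?] /andP[? ?] /andP[? ?] /andP[? ?] ?; lra. Qed.

Section Deterministic.
Variables (R : realType) (n r K : nat) (sigma : 'I_n -> 'I_r) (p q : R).
Hypotheses (r_ge2 : (2 <= r)%N) (K_ge2 : (2 <= K)%N) (nE : n = (r * K)%N).
Hypothesis card_sigma : forall k : 'I_r, #|[set i | sigma i == k]| = K.
Hypotheses (q_ge0 : 0 <= q) (ltqp : q < p).

Definition expected_adj : 'M[R]_n :=
  \matrix_(i, j) (if i == j then 1 else edge_prob sigma p q i j).

Let ones : 'M[R]_(1, n) := const_mx 1.
Let ind : 'M[R]_(r, n) := \matrix_(k, i) (sigma i == k)%:R.

Lemma expected_adjE :
  expected_adj = (1 - p)%:M + q *: (ones^T *m ones) + (p - q) *: (ind^T *m ind).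
Proof.
apply/matrixP => i j; rewrite !mxE big_ord1 !mxE.
under eq_bigr do rewrite !mxE.
rewrite (bigD1 (sigma i)) //= eqxx mul1r big1 ?addr0; last first.
  by move=> k /negPf; rewrite eq_sym => ->; rewrite mul0r.
rewrite /edge_prob eq_sym (eq_sym (sigma i)); case: (eqVneq j i) => [->|_].
  by rewrite eqxx /=; ring.
by case: (_ == _) => /=; ring.
Qed.

Lemma ones_tight : ones *m ones^T = n%:R%:M.
Proof.
apply/matrixP => i j; rewrite !ord1 !mxE eqxx.
by under eq_bigr do rewrite !mxE mulr1; rewrite sumr_const card_ord.
Qed.

Lemma ind_tight : ind *m ind^T = K%:R%:M.
Proof.
apply/matrixP => k l; rewrite !mxE.
under eq_bigr do rewrite !mxE.
case: (eqVneq k l) => [->|kl].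
  rewrite mulr1n -(card_sigma l) -sum1_card natr_sum [RHS]big_mkcond /=.
  by apply: eq_bigr => i _; rewrite inE; case: eqP => _; rewrite ?mulr1 ?mulr0.
rewrite mulr0n big1 // => i _; case: eqP => [->|_]; last by rewrite mul0r.
by rewrite (negPf kl) mulr0.
Qed.

Lemma ones_ind : ones = const_mx 1 *m ind.
Proof.
apply/rowP => j; rewrite !mxE (bigD1 (sigma j)) //= !mxE eqxx mulr1 big1 ?addr0 //.
by move=> k /negPf nk; rewrite !mxE eq_sym nk mulr0.
Qed.

Lemma qf_expected_adj x : qf expected_adj x =
  (1 - p) * qf 1%:M x + q * qf 1%:M (x *m ones^T) + (p - q) * qf 1%:M (x *m ind^T).
Proof. by rewrite expected_adjE !qfD !qfZ !qf_gram -scalemx1 qfZ. Qed.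

Variables (A : 'M[R]_n) (s : seq R) (delta : R).
Hypotheses (symA : A^T = A) (specA : sorted_spectrum A s).
Hypothesis devA : forall x, `|qf (A - expected_adj) x| <= delta * qf 1%:M x.

Let pq0 : 0 <= p - q. Proof. by rewrite subr_ge0 ltW. Qed.
Let K_gt0 : 0 < K%:R :> R. Proof. by rewrite ltr0n; lia. Qed.
Let ltrn : (r < n)%N. Proof. by rewrite nE; nia. Qed.
Let n_gt0 : 0 < n%:R :> R. Proof. by rewrite ltr0n; lia. Qed.

Let qfA_le x : qf A x <= qf expected_adj x + delta * qf 1%:M x.
Proof.
have := devA x; rewrite ler_norml => /andP[_].
by rewrite qfD qfN lerBlDl addrC.
Qed.

Let qfA_ge x : qf expected_adj x - delta * qf 1%:M x <= qf A x.
Proof.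
have := devA x; rewrite ler_norml => /andP[+ _].
rewrite qfD qfN; lra.
Qed.

Let x1 x : qf 1%:M (x *m ones^T) <= n%:R * qf 1%:M x.
Proof. exact: bessel_tight ones_tight. Qed.
Let xi x : qf 1%:M (x *m ind^T) <= K%:R * qf 1%:M x.
Proof. exact: bessel_tight ind_tight. Qed.

(** Upper bound: Bessel's inequality for both Gram terms on the whole space. Lower bound: the
    constant vector, being a combination of the cluster indicators, attains both. *)
Lemma top_eigenvalue : `|s`_0 - (1 - p + (p - q) * K%:R + q * n%:R)| <= delta.
Proof.
rewrite ler_distl lerBlDr; apply/andP; split; last first.
  apply: (courant_fischer_le symA specA (V := 1%:M)); rewrite ?mxrank1; [lia|lia|].
  move=> w; rewrite mulmx1; have := qfA_le w; rewrite qf_expected_adj.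
  have := ler_wpM2l q_ge0 (x1 w).
  have := ler_wpM2l pq0 (xi w); lra.
rewrite -lerBlDr; apply: (courant_fischer_ge symA specA (V := ones)); first lia.
  rewrite (rank_tight _ ones_tight) // gt_eqF //.
move=> w; apply: le_trans (qfA_ge _); rewrite qf_expected_adj.
rewrite -mulmxA ones_tight mul_mx_scalar qf1Z.
have -> : w *m ones *m ind^T = K%:R *: (w *m const_mx 1).
  by rewrite -mulmxA {1}ones_ind -mulmxA ind_tight !mul_mx_scalar -scalemxAr.
rewrite qf1Z !(qf_tight _ ones_tight).
have -> : qf 1%:M (w *m (const_mx 1 : 'M[R]_(1, r))) = r%:R * qf 1%:M w.
  rewrite !qf1E big_ord1 (eq_bigr (fun=> w 0 0 ^+ 2)).
    by rewrite sumr_const card_ord mulr_natl.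
  by move=> i _; rewrite mxE big_ord1 mxE mulr1.
have nR : n%:R = r%:R * K%:R :> R by rewrite [in LHS]nE natrM.
by rewrite nR le_eqVlt; apply/orP; left; apply/eqP; ring.
Qed.

(** From above, orthogonality to [ones] kills the [q] term at the cost of one dimension; from below,
    the span of the indicators attains the [p - q] term. *)
Lemma middle_eigenvalue i : (0 < i < r)%N ->
  `|s`_i - (1 - p + (p - q) * K%:R)| <= delta.
Proof.
move=> /andP[i0 ir]; rewrite ler_distl; apply/andP; split; last first.
  apply: (courant_fischer_le symA specA (V := kermx ones^T)).
  - nia.
  - by rewrite mxrank_ker mxrank_tr (rank_tight _ ones_tight) ?gt_eqF //; lia.
  move=> w; set x := _ *m _; have := qfA_le x; rewrite qf_expected_adj.
  have -> : x *m ones^T = 0 by rewrite -mulmxA mulmx_ker mulmx0.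
  rewrite qf0 mulr0.
  have := ler_wpM2l pq0 (xi x); lra.
apply: (courant_fischer_ge symA specA (V := ind)); first nia.
  by rewrite (rank_tight _ ind_tight) // gt_eqF.
move=> w; apply: le_trans (qfA_ge _); rewrite qf_expected_adj.
rewrite -[w *m ind *m ind^T]mulmxA ind_tight mul_mx_scalar qf1Z.
rewrite !(qf_tight _ ind_tight).
have := mulr_ge0 q_ge0 (qf1_ge0 (w *m ind *m ones^T)); lra.
Qed.

(** Vectors orthogonal to the indicators are also orthogonal to [ones], which leaves only the scalar
    part; from below, both Gram terms are nonnegative. *)
Lemma bulk_eigenvalue i : (r <= i < n)%N -> `|s`_i - (1 - p)| <= delta.
Proof.
move=> /andP[ri iltn]; rewrite ler_distl; apply/andP; split; last first.
  apply: (courant_fischer_le symA specA (V := kermx ind^T)) => //.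
    by rewrite mxrank_ker mxrank_tr (rank_tight _ ind_tight) ?gt_eqF //; lia.
  move=> w; set x := _ *m _; have := qfA_le x; rewrite qf_expected_adj.
  have xi0 : x *m ind^T = 0 by rewrite -mulmxA mulmx_ker mulmx0.
  have -> : x *m ones^T = 0 by rewrite ones_ind trmx_mul mulmxA xi0 mul0mx.
  rewrite xi0 !qf0 !mulr0; lra.
apply: (courant_fischer_ge symA specA (V := 1%:M)); rewrite ?mxrank1 //.
move=> w; apply: le_trans (qfA_ge _); rewrite qf_expected_adj mulmx1.
have := mulr_ge0 q_ge0 (qf1_ge0 (w *m ones^T)).
have := mulr_ge0 pq0 (qf1_ge0 (w *m ind^T)); lra.
Qed.

Lemma estimates (c4 : R) rh :
  8 * delta <= (p - q) * K%:R ->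
  2 * delta <= c4 * Num.sqrt (p * (1 - q) * n%:R) ->
  (2 <= rh <= n.-1)%N ->
  (forall i : nat, (2 <= i <= n.-1)%N -> gap s i <= gap s rh) ->
  [/\ @Khat R n rh = K%:R :> R,
      Num.max `|@phat R n s rh - p| `|@qhat R n s - q|
        <= c4 * Num.sqrt (p * (1 - q) * n%:R) / K%:R
    & p / 4 + 3 * q / 4 <= @thresh R n s rh <= 3 * p / 4 + q / 4].
Proof.
move=> d8 d2 /andP[rh2 rhn] gapmax.
have pqK : 0 < (p - q) * K%:R by rewrite mulr_gt0 // subr_gt0.
(* [gap s i] compares the zero-based entries [i - 1] and [i], so it straddles two levels only at
   [i = r]: for [2 <= i < r] both are middle eigenvalues, for [i > r] both are bulk ones. *)
have rhE : rh = r.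
  have hr : (2 <= r <= n.-1)%N by move: ltrn r_ge2; clear; lia.
  have hrh : (rh < n)%N by move: rhn ltrn; clear; lia.
  have L20 : 0 < 1 - p + (p - q) * K%:R - (1 - p) by rewrite addrAC subrr add0r.
  have L28 : 8 * delta <= 1 - p + (p - q) * K%:R - (1 - p) by rewrite [1 - p + _]addrC addrK.
  have m1 : (0 < r.-1 < r)%N by move: r_ge2; clear; lia.
  have m2 : (r <= r < n)%N by rewrite leqnn ltrn.
  have := gapmax r hr; rewrite /gap /eig /= => gr.
  have cmp := separation_contra L20 L28 (middle_eigenvalue m1) (bulk_eigenvalue m2) _ _ gr.
  case: (ltngtP rh r) => // lt; exfalso.
    by apply: (cmp (1 - p + (p - q) * K%:R)); apply: middle_eigenvalue; move: lt rh2; clear; lia.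
  by apply: (cmp (1 - p)); apply: bulk_eigenvalue; move: lt hrh; clear; lia.
subst rh.
have r0 : r%:R != 0 :> R by rewrite pnatr_eq0 -lt0n ltnW.
have KhE : @Khat R n r = K%:R :> R.
  by rewrite /Khat {1}nE natrM mulrAC mulfV // mul1r.
have K2 : 2 <= K%:R :> R by rewrite ler_nat.
have Kn : K%:R <= n%:R :> R by rewrite ler_nat nE leq_pmull // ltnW.
have := top_eigenvalue; have := @middle_eigenvalue 1; rewrite !ler_distl.
move=> /(_ r_ge2)/andP[s1l s1u] /andP[s0l s0u].
have del0 : 0 <= delta by lra.
have hp : `|@phat R n s r - p| <= 2 * delta / K%:R.
  rewrite /phat KhE /eig /=.
  set N := (_ + _ - _); have nK : 0 < n%:R * (K%:R - 1) :> R by rewrite mulr_gt0 //; lra.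
  rewrite -[p](mulfK (lt0r_neq0 nK)) -mulrBl normrM normfV (gtr0_norm nK).
  rewrite ler_pdivrMr //.
  (* The weights [K] and [n - K] cancel everything but [p]: at the unperturbed eigenvalues [N] is
     exactly [p * n * (K - 1)], and the weights sum to [n]. *)
  have N1 : `|N - p * (n%:R * (K%:R - 1))| <= n%:R * delta.
    have a0 : 0 <= K%:R :> R by lra.
    have b0 : 0 <= n%:R - K%:R :> R by lra.
    have := ler_wpM2l a0 s0l; have := ler_wpM2l a0 s0u.
    have := ler_wpM2l b0 s1l; have := ler_wpM2l b0 s1u.
    rewrite /N ler_norml; lra.
  apply: le_trans N1 _.
  have -> : 2 * delta / K%:R * (n%:R * (K%:R - 1)) = n%:R * delta * (2 * (K%:R - 1) / K%:R) :> R by ring.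
  rewrite ler_peMr ?mulr_ge0 ?ler0n // ler_pdivlMr //; lra.
have hq : `|@qhat R n s - q| <= 2 * delta / K%:R.
  rewrite /qhat /eig /= -[q](mulfK (lt0r_neq0 n_gt0)) -mulrBl normrM normfV (gtr0_norm n_gt0).
  apply: (@le_trans _ _ (2 * delta / n%:R)).
    rewrite ler_pM2r ?invr_gt0 // ler_norml; lra.
  by rewrite ler_wpM2l ?lef_pV2 ?posrE //; lra.
(* An error of [(p - q) / 4] in each estimate is the exact slack in the claim on the threshold. *)
have dK : 2 * delta / K%:R <= (p - q) / 4 by rewrite ler_pdivrMr //; lra.
split=> //.
  have le2 : 2 * delta / K%:R <= c4 * Num.sqrt (p * (1 - q) * n%:R) / K%:R.
    by rewrite ler_pM2r ?invr_gt0.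
  by rewrite ge_max (le_trans hp) ?(le_trans hq).
move: hp hq; rewrite !ler_distl /thresh => /andP[? ?] /andP[? ?].
apply/andP; split; lra.
Qed.

End Deterministic.

(** * Closed walks *)

Section Walks.
Variable T : finType.

Definition fcons L (a : T) (g : {ffun 'I_L -> T}) : {ffun 'I_L.+1 -> T} :=
  [ffun i => if unlift ord0 i is Some j then g j else a].

Lemma fcons0 L a (g : {ffun 'I_L -> T}) : fcons a g ord0 = a.
Proof. by rewrite ffunE unlift_none. Qed.

Lemma fconsS L a (g : {ffun 'I_L -> T}) j : fcons a g (lift ord0 j) = g j.
Proof. by rewrite ffunE liftK. Qed.

Lemma sum_fcons (V : nmodType) L (F : {ffun 'I_L.+1 -> T} -> V) :
  \sum_f F f = \sum_a \sum_(g : {ffun 'I_L -> T}) F (fcons a g).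
Proof.
rewrite pair_bigA /= (reindex (fun p : T * {ffun 'I_L -> T} => fcons p.1 p.2)) //=.
exists (fun f : {ffun 'I_L.+1 -> T} => (f ord0, [ffun j => f (lift ord0 j)])) => [[a g] _|f _] /=.
  by rewrite fcons0; congr (_, _); apply/ffunP => j; rewrite ffunE fconsS.
by apply/ffunP => i; rewrite ffunE; case: unliftP => [j ->|->] //; rewrite ffunE.
Qed.

(** A walk is stored as its [L + 1] vertices; step [l] goes from vertex [l] to vertex [l + 1]. *)
Definition src L (u : {ffun 'I_L.+1 -> T}) (l : 'I_L) : T := u (widen_ord (leqnSn L) l).
Definition tgt L (u : {ffun 'I_L.+1 -> T}) (l : 'I_L) : T := u (lift ord0 l).
Definition closed_walk L (u : {ffun 'I_L.+1 -> T}) : bool := u ord_max == u ord0.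

End Walks.

Lemma expmx_walk (R : comPzRingType) n (M : 'M[R]_n) L i j :
  (M ^+ L) i j = \sum_(g : {ffun 'I_L -> 'I_n} | fcons i g ord_max == j)
     \prod_(l < L) M (src (fcons i g) l) (tgt (fcons i g) l).
Proof.
elim: L i => [|L IH] i.
  rewrite expr0 mxE big_mkcond /= (big_pred1 [ffun=> i]); last first.
    by move=> f; apply/esym/eqP/ffunP; case.
  by rewrite big_ord0 (_ : ord_max = ord0) ?fcons0; [case: eqP|apply/val_inj].
rewrite exprS mxE [RHS]big_mkcond /= sum_fcons; apply: eq_bigr => k _.
rewrite IH mulr_sumr big_mkcond /=; apply: eq_bigr => g _.
have -> : ord_max = lift ord0 (@ord_max L) by apply/val_inj.
rewrite fconsS; case: ifP => // _; rewrite big_ord_recl.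
rewrite /src /tgt fconsS fcons0; congr (_ * _).
  by congr (M _ _); rewrite (_ : widen_ord _ _ = ord0) ?fcons0 //; apply/val_inj.
apply: eq_bigr => l _; rewrite !fconsS; congr (M _ _).
by rewrite -(fconsS i (fcons k g)); congr (fcons _ _ _); apply/val_inj.
Qed.

Lemma trace_walk (R : comPzRingType) n (M : 'M[R]_n) L :
  \tr (M ^+ L) = \sum_(u : {ffun 'I_L.+1 -> 'I_n} | closed_walk u)
     \prod_(l < L) M (src u l) (tgt u l).
Proof.
rewrite [RHS]big_mkcond sum_fcons; apply: eq_bigr => i _.
rewrite expmx_walk big_mkcond; apply: eq_bigr => g _.
by rewrite /closed_walk fcons0.
Qed.

Section Edges.
Variable n : nat.

Definition edge (a b : 'I_n) : 'I_n * 'I_n := if (a < b)%N then (a, b) else (b, a).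

Lemma edge_eq a b c d :
  (edge a b == edge c d) = ((a == c) && (b == d)) || ((a == d) && (b == c)).
Proof.
rewrite /edge; do 2!case: ifP => ?; rewrite !xpair_eqE -!val_eqE /=; apply/idP/idP; lia.
Qed.

Lemma edge_lt a b : a != b -> ((edge a b).1 < (edge a b).2)%N.
Proof. by rewrite /edge -val_eqE /=; case: ifP => /=; lia. Qed.

Variable L : nat.
Implicit Type u : {ffun 'I_L.+1 -> 'I_n}.

Definition step_edge u (l : 'I_L) := edge (src u l) (tgt u l).
Definition mult u (e : 'I_n * 'I_n) : nat := #|[pred l | step_edge u l == e]|.
Definition loopless u := [forall l, src u l != tgt u l].

(** Repetition of edges is phrased through positions only, which makes it visibly invariant under
    relabelling of vertices; [good_mult] restates it by multiplicities. *)
Definition good u := [&& closed_walk u, loopless u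
  & [forall l, exists l', (l' != l) && (step_edge u l' == step_edge u l)]].

Definition nverts (T : finType) (u : {ffun 'I_L.+1 -> T}) : nat := #|[pred x | x \in codom u]|.

Lemma good_mult u : good u = [&& closed_walk u, loopless u & [forall e, mult u e != 1%N]].
Proof.
rewrite /good; do 2!congr (_ && _); apply/idP/idP => [/forallP H|/forallP H].
  apply/forallP => e; apply/negP => /eqP /mem_card1[l le].
  have := le l; rewrite !inE eqxx => /eqP el.
  have /existsP[l' /andP[/negP nl /eqP el']] := H l; apply: nl.
  by have := le l'; rewrite !inE el' el eqxx => <-.
apply/forallP => l; apply: contraT => /existsPn H'.
case/negP: (H (step_edge u l)); rewrite /mult (eq_card (_ : _ =i pred1 l)) ?card1 // => l'.
rewrite !inE; apply/idP/idP => [/eqP e|/eqP-> //].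
by have := H' l'; rewrite e eqxx andbT negbK.
Qed.

Lemma mult_gt0 u e : (0 < mult u e)%N = (e \in codom (step_edge u)).
Proof.
apply/card_gt0P/codomP => [[l]|[l ->]]; first by rewrite inE => /eqP <-; exists l.
by exists l; rewrite inE.
Qed.

End Edges.

(** Induction from the front: a vertex not met later leaves by an edge not met later. This is the
    bound on the vertices of a connected graph by its edges plus one. *)
Lemma size_undup_path (n : nat) (a : 'I_n) (s : seq 'I_n) :
  (size (undup (a :: s)) <= (size (undup (pairmap (@edge n) a s))).+1)%N.
Proof.
elim: s a => [//|b s IH] a; have := IH b.
have mem_edge e c t : e \in pairmap (@edge n) c t -> (e.1 \in c :: t) && (e.2 \in c :: t).
  elim: t c => [//|d t IHt] c /=; rewrite in_cons => /orP[/eqP ->|/IHt].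
    by rewrite /edge; case: ifP; rewrite /= !inE !eqxx ?orbT.
  by rewrite !(in_cons c) => /andP[-> ->]; rewrite !orbT.
have undupE (S : eqType) (c : S) t :
  size (undup (c :: t)) = if c \in t then size (undup t) else (size (undup t)).+1.
  by rewrite /=; case: ifP.
rewrite (undupE _ a) -/(pairmap _ _ _) [pairmap _ a _]/= (undupE _ (edge a b)) => {}IH.
case: ifP => [_|/negbT at_].
  by apply: leq_trans IH _; rewrite ltnS; case: ifP.
rewrite ifN // ; apply/negP => /mem_edge.
by rewrite /edge; case: ifP => _ /= /andP[]; rewrite (negPf at_).
Qed.

Lemma nverts_le n L (u : {ffun 'I_L.+1 -> 'I_n}) :
  (nverts u <= #|[pred e | e \in codom (step_edge u)]|.+1)%N.
Proof.
have cardE' (T : finType) (t : seq T) : #|[pred e | e \in t]| = size (undup t).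
  rewrite -(card_uniqP (undup_uniq t)); apply: eq_card => e; by rewrite !inE mem_undup.
rewrite /nverts !cardE'.
have -> : codom u = u ord0 :: [seq u (lift ord0 l) | l <- enum 'I_L].
  by rewrite codomE enum_ordSl /= -map_comp.
have -> : codom (step_edge u) = pairmap (@edge n) (u ord0) [seq u (lift ord0 l) | l <- enum 'I_L].
  apply: (@eq_from_nth _ (u ord0, u ord0)).
    by rewrite size_pairmap size_codom size_map size_enum_ord card_ord.
  move=> i; rewrite size_codom card_ord => ltiL.
  rewrite (nth_pairmap (u ord0)) 1?size_map ?size_enum_ord //.
  have nthE k (ltk : (k < L)%N) : nth (Ordinal ltk) (enum 'I_L) k = Ordinal ltk.
    by apply/val_inj; rewrite /= nth_enum_ord.
  have -> : codom (step_edge u) = [seq step_edge u l | l <- enum 'I_L] by [].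
  rewrite [LHS](nth_map (Ordinal ltiL)) ?size_enum_ord // nthE.
  rewrite [X in edge _ X](nth_map (Ordinal ltiL)) ?size_enum_ord // nthE.
  rewrite /step_edge /src /tgt; congr (edge _ _).
  case: i ltiL => [|i] ltiL /=; first by congr (u _); apply/val_inj.
  rewrite (nth_map (Ordinal (ltnW ltiL))) ?size_enum_ord 1?ltnW // nthE.
  by congr (u _); apply/val_inj.
exact: size_undup_path.
Qed.

(** * Independent centered edges *)

Section IndependentEdges.
Variables (R : realFieldType) (n : nat).
Implicit Types (P : 'I_n -> 'I_n -> R) (x : sample n).

(** For [P := edge_prob sigma p q] this is convertible to [sbm_weight]. *)
Definition bern_weight P x : R :=
  \prod_(i : 'I_n) \prod_(j : 'I_n)
    (if (i < j)%N then (if x i j then P i j else 1 - P i j)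
     else (if x i j then 0 else 1)).

Definition centered P x : 'M[R]_n :=
  \matrix_(i, j) (if i == j then 0
    else (x (edge i j).1 (edge i j).2)%:R - P (edge i j).1 (edge i j).2).

Lemma centered_sym P x : (centered P x)^T = centered P x.
Proof.
apply/matrixP => i j; rewrite !mxE eq_sym.
by rewrite (_ : edge j i = edge i j) //; apply/eqP; rewrite edge_eq !eqxx orbT.
Qed.

Lemma bern_weight_ge0 P x : (forall i j, 0 <= P i j <= 1) -> 0 <= bern_weight P x.
Proof.
move=> P01; apply: prodr_ge0 => i _; apply: prodr_ge0 => j _.
by have /andP[P0 P1] := P01 i j; do 2!case: ifP => _ //; rewrite subr_ge0.
Qed.

(** Independence of the entries [i < j]: the sum over samples distributes over the product, and each
    remaining entry contributes 1, its only weighted value being [false]. *)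
Lemma expect_prod P (g : 'I_n -> 'I_n -> bool -> R) :
  \sum_x bern_weight P x * \prod_(i : 'I_n) \prod_(j : 'I_n) (if (i < j)%N then g i j (x i j) else 1) =
  \prod_(i : 'I_n) \prod_(j : 'I_n) (if (i < j)%N then P i j * g i j true + (1 - P i j) * g i j false else 1).
Proof.
pose w (i j : 'I_n) (b : bool) : R := if (i < j)%N then (if b then P i j else 1 - P i j) * g i j b
                    else (if b then 0 else 1).
transitivity (\sum_(x : sample n) \prod_i \prod_j w i j (x i j)).
  apply: eq_bigr => x _; rewrite /bern_weight -big_split; apply: eq_bigr => i _.
  rewrite -big_split; apply: eq_bigr => j _; rewrite /w.
  by case: (i < j)%N; rewrite /= ?mulr1.
rewrite -(bigA_distr_bigA (fun i (f : {ffun 'I_n -> bool}) => \prod_j w i j (f j))).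
apply: eq_bigr => i _; rewrite -bigA_distr_bigA; apply: eq_bigr => j _.
by rewrite big_bool /w; case: ifP => _ /=; rewrite ?add0r.
Qed.

Lemma bern_weight_sum1 P : \sum_x bern_weight P x = 1.
Proof.
have one (c d : 'I_n -> 'I_n -> R) : (forall i j, c i j = 1) -> (forall i j, d i j = 1) ->
    \prod_(i : 'I_n) \prod_(j : 'I_n) (if (i < j)%N then c i j else d i j) = 1.
  by move=> c1 d1; rewrite big1 // => i _; rewrite big1 // => j _; rewrite c1 d1 if_same.
transitivity (\sum_x bern_weight P x *
    \prod_(i : 'I_n) \prod_(j : 'I_n) (if (i < j)%N then 1 else 1)).
  by apply: eq_bigr => x _; rewrite (one (fun _ _ => 1) (fun _ _ => 1)) // mulr1.
rewrite (expect_prod P (fun _ _ _ => 1)).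
rewrite (one (fun i j => P i j * 1 + (1 - P i j) * 1) (fun _ _ => 1)) // => i j; ring.
Qed.

(* The [k]-th central moment of a Bernoulli variable of parameter [a]. *)
Definition moment (a : R) k := a * (1 - a) ^+ k + (1 - a) * (- a) ^+ k.

Lemma moment0 a : moment a 0 = 1. Proof. by rewrite /moment; ring. Qed.
Lemma moment1 a : moment a 1 = 0. Proof. by rewrite /moment; ring. Qed.

(** The variance [a * (1 - a)] factors out of every moment of positive order; the cofactor is at
    most [(1 - a) + a = 1] in absolute value once the order reaches 2. *)
Lemma moment_le a k : 0 <= a <= 1 -> (2 <= k)%N -> `|moment a k| <= a * (1 - a).
Proof.
case: k => [//|k] /andP[a0 a1] k1; have b0 : 0 <= 1 - a by rewrite subr_ge0.
have -> : moment a k.+1 = a * (1 - a) * ((1 - a) ^+ k - (- a) ^+ k).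
  by rewrite /moment !exprS; ring.
rewrite normrM (ger0_norm (mulr_ge0 a0 b0)) ler_piMr ?mulr_ge0 //.
apply: le_trans (ler_normB _ _) _; rewrite !normrX normrN (ger0_norm a0) (ger0_norm b0).
case: k k1 => // k _; rewrite !exprS.
have : (1 - a) * (1 - a) ^+ k <= 1 - a by rewrite ler_piMr // exprn_ile1 // lerBlDr lerDl.
have : a * a ^+ k <= a by rewrite ler_piMr // exprn_ile1.
lra.
Qed.

Variable L : nat.
Implicit Type u : {ffun 'I_L.+1 -> 'I_n}.

Lemma prod_edges u (F : 'I_n * 'I_n -> R) : loopless u ->
  \prod_(l < L) F (step_edge u l) = \prod_(i : 'I_n) \prod_(j : 'I_n)
    (if (i < j)%N then F (i, j) ^+ mult u (i, j) else 1).
Proof.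
move=> /forallP lu; rewrite pair_bigA /= (partition_big (step_edge u) xpredT) //=.
apply: eq_bigr => -[i j] _ /=.
rewrite (eq_bigr (fun=> F (i, j))) => [|l /eqP-> //].
rewrite prodr_const -/(mult u (i, j)); case: ifP => // /negbT nij.
case: (posnP (mult u (i, j))) => [->|]; first by rewrite expr0.
rewrite mult_gt0 => /codomP[l el].
by have := edge_lt (lu l); rewrite -[edge _ _]/(step_edge u l) -el /= (negPf nij).
Qed.

Lemma centered_walk P x u : \prod_(l < L) centered P x (src u l) (tgt u l) =
  (loopless u)%:R * \prod_(i : 'I_n) \prod_(j : 'I_n)
    (if (i < j)%N then ((x i j)%:R - P i j) ^+ mult u (i, j) else 1).
Proof.
case: (boolP (loopless u)) => [lu|]; last first.
  rewrite mul0r negb_forall => /existsP[l]; rewrite negbK => ul.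
  by rewrite (bigD1 l) //= mxE ul mul0r.
rewrite mul1r -(prod_edges (fun e => (x e.1 e.2)%:R - P e.1 e.2)) //.
by apply: eq_bigr => l _; rewrite mxE (negPf (forallP lu l)).
Qed.

Lemma expect_walk P u :
  \sum_x bern_weight P x * \prod_(l < L) centered P x (src u l) (tgt u l) =
  (loopless u)%:R * \prod_(i : 'I_n) \prod_(j : 'I_n)
    (if (i < j)%N then moment (P i j) (mult u (i, j)) else 1).
Proof.
under eq_bigr do rewrite centered_walk mulrCA.
rewrite -mulr_sumr; congr (_ * _).
rewrite (expect_prod P (fun i j (b : bool) => (b%:R - P i j) ^+ mult u (i, j))).
by apply: eq_bigr => i _; apply: eq_bigr => j _; rewrite sub0r.
Qed.

(** An edge used once contributes the vanishing first moment. Otherwise each distinct edge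
    contributes at most [t <= 1], and [nverts_le] bounds their number from below. *)
Lemma expect_walk_le P t u : closed_walk u ->
  (forall i j, 0 <= P i j <= 1) -> (forall i j, P i j * (1 - P i j) <= t) ->
  0 <= t <= 1 ->
  \sum_x bern_weight P x * \prod_(l < L) centered P x (src u l) (tgt u l) <=
  (good u)%:R * t ^+ (nverts u).-1.
Proof.
move=> cu P01 Pt /andP[t0 t1]; rewrite expect_walk good_mult cu /=.
case: (boolP (loopless u)) => [lu|_]; last by rewrite !mul0r.
rewrite mul1r /=; case: (boolP [forall _, _]) => [/forallP m1|]; last first.
  rewrite negb_forall mul0r => /existsP[[i j]]; rewrite negbK => /eqP m1.
  have : (0 < mult u (i, j))%N by rewrite m1.
  rewrite mult_gt0 => /codomP[l el].
  have := edge_lt (forallP lu l); rewrite -[edge _ _]/(step_edge u l) -el /= => ltij.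
  by rewrite (bigD1 i) //= (bigD1 j) //= ltij m1 moment1 !mul0r.
rewrite mul1r; apply: le_trans (ler_norm _) _.
set S := [pred e | e \in codom (step_edge u)].
apply: (@le_trans _ _ (t ^+ #|S|)); last first.
  apply: ler_wiXn2l => //; rewrite -subn1 leq_subLR add1n; exact: nverts_le.
rewrite pair_bigA normr_prod /= -prodr_const [leRHS]big_mkcond /=.
apply: ler_prod => -[i j] _ /=; rewrite normr_ge0 /=.
rewrite inE -mult_gt0; case: (posnP (mult u (i, j))) => [->|m0].
  by rewrite moment0; case: ifP; rewrite normr1.
have : (2 <= mult u (i, j))%N by have := m1 (i, j); move: m0; case: (mult _ _) => [|[]].
move=> m2; case: ifP => [_|/negbT nij].
  by apply: le_trans (moment_le (P01 i j) m2) (Pt i j).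
move: m0; rewrite mult_gt0 => /codomP[l el].
by have := edge_lt (forallP lu l); rewrite -[edge _ _]/(step_edge u l) -el /= (negPf nij).
Qed.

Lemma expect_trace_le P t :
  (forall i j, 0 <= P i j <= 1) -> (forall i j, P i j * (1 - P i j) <= t) ->
  0 <= t <= 1 ->
  \sum_x bern_weight P x * \tr (centered P x ^+ L) <=
  \sum_(u : {ffun 'I_L.+1 -> 'I_n} | good u) t ^+ (nverts u).-1.
Proof.
move=> P01 Pt t01; under eq_bigr do rewrite trace_walk mulr_sumr.
rewrite exchange_big /= [leLHS]big_mkcond [leRHS]big_mkcond /=.
apply: ler_sum => u _; case: ifP => [cu|/negbT ncu].
  apply: le_trans (expect_walk_le cu P01 Pt t01) _.
  by case: (good u); rewrite ?mul1r ?mul0r.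
by rewrite /good (negPf ncu).
Qed.

End IndependentEdges.

(* [3 (b - 1/3)] takes the values 2 and -1, and all its moments except the
   first are at least 1, so each good walk contributes at least 1. *)
Lemma card_good_le (R : realFieldType) (m L : nat) :
  #|[pred u : {ffun 'I_L.+1 -> 'I_m} | good u]|%:R <=
  \sum_(y : sample m) bern_weight (fun _ _ => 3^-1) y
     * \tr ((3 *: centered (fun _ _ => 3^-1) y) ^+ L) :> R.
Proof.
pose P (_ _ : 'I_m) : R := 3^-1; rewrite -/P.
have mom k : k != 1%N -> 1 <= 3 ^+ k * moment 3^-1 k :> R.
  have -> : 3 ^+ k * moment 3^-1 k = 3^-1 * 2 ^+ k + 2 / 3 * (- 1) ^+ k :> R.
    rewrite /moment mulrDr !(mulrCA (3 ^+ k)) -!exprMn.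
    by congr (_ * _ ^+ _ + _ * _ ^+ _); field.
  have sg j : (-1 <= (-1) ^+ j :> R) && ((-1) ^+ j <= 1 :> R).
    by rewrite -signr_odd; case: (odd j); rewrite /= ?expr1 ?expr0; lra.
  have p2 j : 1 <= 2 ^+ j :> R by rewrite exprn_ege1 // ler1n.
  case: k => [_|[//|[|k]] _]; first by rewrite !expr0; lra.
    by rewrite !exprS !expr0; lra.
  by have /andP[] := sg k; have := p2 k; rewrite !exprS; lra.
have mom1 : moment 3^-1 1 = 0 :> R by exact: moment1.
under eq_bigr do rewrite trace_walk mulr_sumr.
rewrite exchange_big /= -sum1_card natr_sum [leLHS]big_mkcond [leRHS]big_mkcond /=.
apply: ler_sum => u _.
case: (boolP (closed_walk u)) => cu; last by rewrite inE /good (negPf cu).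
have -> : \sum_y bern_weight P y * \prod_(l < L) (3 *: centered P y) (src u l) (tgt u l) =
    (loopless u)%:R * \prod_(i : 'I_m) \prod_(j : 'I_m)
      (if (i < j)%N then 3 ^+ mult u (i, j) * moment 3^-1 (mult u (i, j)) else 1).
  transitivity (3 ^+ L * \sum_y bern_weight P y * \prod_(l < L) centered P y (src u l) (tgt u l)).
    rewrite mulr_sumr; apply: eq_bigr => y _; rewrite mulrCA; congr (_ * _).
    rewrite -[X in 3 ^+ X]card_ord -prodr_const -big_split /=.
    by apply: eq_bigr => l _; rewrite mxE.
  rewrite expect_walk mulrCA; case: (boolP (loopless u)) => [lu|_]; last by rewrite !mul0r.
  congr (_ * _); have -> : 3 ^+ L = \prod_(i : 'I_m) \prod_(j : 'I_m)
      (if (i < j)%N then 3 ^+ mult u (i, j) else 1) :> R.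
    by rewrite -(prod_edges (fun=> 3 : R) lu) prodr_const card_ord.
  rewrite -big_split; apply: eq_bigr => i _; rewrite -big_split; apply: eq_bigr => j _ /=.
  by case: ifP => _ //; rewrite mulr1.
rewrite inE good_mult cu /=; case: (loopless u); rewrite ?mul0r // mul1r /=.
case: (boolP [forall _, _]) => [/forallP m1|_].
  apply: (big_ind (fun a : R => 1 <= a)) => // [a b|i _]; first exact: mulr_ege1.
  apply: (big_ind (fun a : R => 1 <= a)) => // [a b|j _]; first exact: mulr_ege1.
  by case: ifP => // _; apply: mom.
(* A closed loopless walk that is not good contributes a product of nonnegative factors, so it can
   only enlarge the right-hand side. *)
apply: prodr_ge0 => i _; apply: prodr_ge0 => j _; case: ifP => // _.
case: (eqVneq (mult u (i, j)) 1%N) => [->|/mom]; first by rewrite mom1 mulr0.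
exact: le_trans.
Qed.

(** * Comparison of walks on different numbers of vertices *)

Section SameKernel.
Variables (I T S : finType).

(** The relation says that one function is an injective relabelling of the other, possibly over
    another vertex set. *)
Definition same_kernel (u : {ffun I -> T}) (w : {ffun I -> S}) : bool :=
  [forall a, forall b, (u a == u b) == (w a == w b)].

Lemma same_kernelP (u : {ffun I -> T}) (w : {ffun I -> S}) :
  reflect (forall a b, (u a == u b) = (w a == w b)) (same_kernel u w).
Proof.
apply: (iffP forallP) => [H a b|H a]; first by have /forallP/(_ b)/eqP := H a.
by apply/forallP => b; rewrite H.
Qed.

(** Functions with the kernel of [u] correspond to injections of its image into [S], counted by the
    falling factorial. *)
Lemma card_same_kernel (u : {ffun I -> T}) :
  #|[pred w | same_kernel u w]| = (#|S| ^_ #|[pred x | x \in codom u]|)%N.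
Proof.
rewrite -[X in (_ ^_ X)%N]card_sig -card_inj_ffuns.
pose u' a : {x | x \in [pred x | x \in codom u]} := exist _ (u a) (codom_f u a).
have u'_onto d : exists a, d = u' a.
  case: d => x xu; have /codomP[a xa] := xu; exists a; exact/val_inj.
pose lift_u (f : {ffun {x | x \in [pred x | x \in codom u]} -> S}) : {ffun I -> S} :=
  [ffun a => f (u' a)].
rewrite -(card_imset (f := lift_u)); last first.
  move=> f g /ffunP fg; apply/ffunP => d; have [a ->] := u'_onto d.
  by have := fg a; rewrite /lift_u !ffunE.
apply: eq_card => w; rewrite inE; apply/same_kernelP/imsetP => [uw|[f]]; last first.
  rewrite inE => /injectiveP injf -> a b; rewrite /lift_u !ffunE (inj_eq injf).
  by rewrite -(inj_eq val_inj).
have inv (d : {x | x \in [pred x | x \in codom u]}) : {a | u a = val d}.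
  exists (iinv (valP d)); exact: f_iinv.
exists [ffun d => w (sval (inv d))]; last first.
  apply/ffunP => a; rewrite /lift_u !ffunE; apply/eqP.
  by rewrite -uw (svalP (inv (u' a))).
rewrite inE; apply/injectiveP => d e; rewrite !ffunE => /eqP.
by rewrite -uw !(svalP (inv _)) => /eqP /val_inj.
Qed.

End SameKernel.

Lemma same_kernel_sym (I T S : finType) (u : {ffun I -> T}) (w : {ffun I -> S}) :
  same_kernel u w = same_kernel w u.
Proof. by apply/same_kernelP/same_kernelP => H a b; rewrite H. Qed.

Lemma same_kernel_codom (I T S : finType) (u : {ffun I -> T}) (w : {ffun I -> S}) :
  same_kernel u w -> (#|[pred x | x \in codom u]| <= #|[pred x | x \in codom w]|)%N.
Proof.
move=> /same_kernelP uw.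
pose g (d : {x | x \in [pred x | x \in codom u]}) : S := w (iinv (valP d)).
have gi : injective g.
  by move=> d e /eqP; rewrite -uw !f_iinv => /eqP /val_inj.
rewrite -card_sig -(card_codom gi).
apply/subset_leq_card/fintype.subsetP => x.
by case/codomP => d ->; rewrite inE; exact: codom_f.
Qed.

Lemma same_kernel_nverts L (T S : finType) (u : {ffun 'I_L.+1 -> T}) (w : {ffun 'I_L.+1 -> S}) :
  same_kernel u w -> nverts u = nverts w.
Proof.
move=> uw; apply/eqP; rewrite eqn_leq !same_kernel_codom //.
by rewrite same_kernel_sym.
Qed.

Lemma same_kernel_good L n m (u : {ffun 'I_L.+1 -> 'I_n}) (w : {ffun 'I_L.+1 -> 'I_m}) :
  same_kernel u w -> good u = good w.
Proof.
move=> /same_kernelP uw; rewrite /good /closed_walk uw.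
congr [&& _, _ & _]; apply: eq_forallb => l; first by rewrite /src /tgt uw.
by apply: eq_existsb => l'; rewrite /step_edge !edge_eq /src /tgt !uw.
Qed.

Lemma ffact_leX n v : (n ^_ v <= n ^ v)%N.
Proof.
elim: v => [//|v IH]; rewrite ffactnSr expnSr leq_mul //; exact: leq_subr.
Qed.

Lemma leX_ffact k m v : (k + v <= m.+1)%N -> (k ^ v <= m ^_ v)%N.
Proof.
elim: v => [//|v IH] h; rewrite ffactnSr expnSr leq_mul ?IH //; lia.
Qed.

(* Double counting of the pairs of walks with the same kernel: a kernel with v
   classes is realized by n^_v walks on n vertices and m^_v walks on m. *)
Lemma good_comparison (R : realFieldType) n m L k :
  (0 < n)%N -> (0 < k)%N -> (k + L <= m)%N ->
  \sum_(u : {ffun 'I_L.+1 -> 'I_n} | good u) (k%:R / n%:R) ^+ (nverts u).-1 <=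
  n%:R / k%:R * #|[pred w : {ffun 'I_L.+1 -> 'I_m} | good w]|%:R :> R.
Proof.
move=> n0 k0 kL.
have nv_gt0 (T : finType) (u : {ffun 'I_L.+1 -> T}) : (0 < nverts u)%N.
  by apply/card_gt0P; exists (u ord0); rewrite inE; exact: codom_f.
have nv_le (T : finType) (u : {ffun 'I_L.+1 -> T}) : (nverts u <= L.+1)%N.
  apply: leq_trans (_ : size (codom u) <= _)%N; last by rewrite size_codom card_ord.
  exact: (leq_trans (card_size (codom u))).
have km v : (v <= L.+1)%N -> (k ^ v <= m ^_ v)%N.
  by move=> vL; apply: leX_ffact; lia.
have mv_gt0 v : (v <= L.+1)%N -> 0 < (m ^_ v)%:R :> R.
  by move=> vL; rewrite ltr0n; apply: leq_trans (km v vL); rewrite expn_gt0 k0.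
(* [c v] spreads the weight of a walk with [v] vertices evenly over the [m ^_ v] walks on [m]
   vertices sharing its kernel. *)
pose c v : R := (k%:R / n%:R) ^+ v.-1 / (m ^_ v)%:R.
apply: (@le_trans _ _ (\sum_(u : {ffun 'I_L.+1 -> 'I_n} | good u)
    \sum_(w : {ffun 'I_L.+1 -> 'I_m} | same_kernel u w) c (nverts u))).
  apply: ler_sum => u _; rewrite sumr_const card_same_kernel card_ord -/(nverts u).
  by rewrite -[leRHS]mulr_natr /c divfK // gt_eqF // mv_gt0.
rewrite (exchange_big_dep (fun w => good w)) /=; last first.
  by move=> u w gu /same_kernel_good <-.
rewrite -sum1_card natr_sum mulr_sumr; under [leRHS]eq_bigl do rewrite inE.
apply: ler_sum => w gw; rewrite mulr1.
rewrite (eq_bigr (fun=> c (nverts w))); last by move=> u /andP[_ /same_kernel_nverts->].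
rewrite (eq_bigl (fun u => same_kernel w u)); last first.
  move=> u; rewrite same_kernel_sym andb_idl // => /same_kernel_good; by rewrite gw.
rewrite sumr_const card_same_kernel card_ord -/(nverts w) /c -[leLHS]mulr_natr.
have := nv_le _ w; have := nv_gt0 _ w; case: (nverts w) => // v _ vL /=.
have n0R : 0 < n%:R :> R by rewrite ltr0n.
have k0R : 0 < k%:R :> R by rewrite ltr0n.
rewrite mulrAC ler_pdivrMr ?mv_gt0 //.
apply: (@le_trans _ _ ((k%:R / n%:R) ^+ v * n%:R ^+ v.+1)).
  by rewrite ler_wpM2l ?exprn_ge0 ?divr_ge0 ?ler0n // -natrX ler_nat ffact_leX.
apply: (@le_trans _ _ (n%:R / k%:R * k%:R ^+ v.+1)); last first.
  by rewrite ler_wpM2l ?divr_ge0 ?ler0n // -natrX ler_nat km.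
rewrite expr_div_n !exprSr !mulrA mulfVK ?expf_neq0 ?gt_eqF // le_eqVlt; apply/orP; left.
apply/eqP; by field; rewrite gt_eqF.
Qed.

(** * Operator norms, traces and a lattice net *)

Section Norms.
Variable R : realType.

Definition dot n (x y : 'rV[R]_n) : R := (x *m y^T) 0 0.

Lemma dotE n (x y : 'rV[R]_n) : dot x y = \sum_i x 0 i * y 0 i.
Proof. by rewrite /dot mxE; apply: eq_bigr => i _; rewrite mxE. Qed.

Lemma dotxx n (x : 'rV[R]_n) : dot x x = qf 1%:M x.
Proof. by rewrite /qf mulmx1. Qed.

Lemma dotC n (x y : 'rV[R]_n) : dot x y = dot y x.
Proof. by rewrite !dotE; apply: eq_bigr => i _; rewrite mulrC. Qed.

Lemma dot_mulmx n m (x : 'rV[R]_n) (M : 'M[R]_(n, m)) y : dot (x *m M) y = dot x (y *m M^T).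
Proof. by rewrite /dot trmx_mul trmxK mulmxA. Qed.

Lemma dotZl n c (x y : 'rV[R]_n) : dot (c *: x) y = c * dot x y.
Proof. by rewrite /dot -scalemxAl mxE. Qed.

Lemma qf1_eq0 n (x : 'rV[R]_n) : qf 1%:M x = 0 -> x = 0.
Proof.
rewrite qf1E => /eqP; rewrite psumr_eq0 => [/allP x0|i _]; last exact: sqr_ge0.
apply/rowP => i; rewrite mxE; apply/eqP; rewrite -sqrf_eq0.
exact: x0 (mem_index_enum i).
Qed.

Lemma qf1_comb n (x y : 'rV[R]_n) a b : qf 1%:M (a *: y - b *: x) =
  a ^+ 2 * qf 1%:M y - 2 * a * b * dot x y + b ^+ 2 * qf 1%:M x.
Proof.
rewrite !qf1E dotE !mulr_sumr -sumrB -big_split; apply: eq_bigr => i _ /=.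
by rewrite !mxE; ring.
Qed.

Lemma cauchy_schwarz n (x y : 'rV[R]_n) : dot x y ^+ 2 <= qf 1%:M x * qf 1%:M y.
Proof.
have [/qf1_eq0 ->|x0] := eqVneq (qf 1%:M x) 0.
  by rewrite qf0 mul0r dotE big1 ?expr0n // => i _; rewrite mxE mul0r.
have xgt : 0 < qf 1%:M x by rewrite lt_def x0 qf1_ge0.
have := qf1_ge0 (qf 1%:M x *: y - dot x y *: x).
have -> : qf 1%:M (qf 1%:M x *: y - dot x y *: x) =
    qf 1%:M x * (qf 1%:M x * qf 1%:M y - dot x y ^+ 2).
  rewrite qf1_comb; ring.
by rewrite pmulr_rge0 // subr_ge0.
Qed.

Lemma qf1_mulmx_frobenius n m (B : 'M[R]_(n, m)) x :
  qf 1%:M (x *m B) <= \tr (B *m B^T) * qf 1%:M x.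
Proof.
rewrite mxtrace_mulC mulrC {1}qf1E /mxtrace mulr_sumr; apply: ler_sum => j _.
have -> : (x *m B) 0 j = dot x (col j B)^T.
  by rewrite dotE mxE; apply: eq_bigr => i _; rewrite !mxE.
apply: le_trans (cauchy_schwarz _ _) _; rewrite ler_wpM2l ?qf1_ge0 // qf1E mxE.
by apply: ler_sum => i _; rewrite !mxE expr2.
Qed.

Lemma trmxX n (A : 'M[R]_n) k : A^T = A -> (A ^+ k)^T = A ^+ k.
Proof.
move=> sA; elim: k => [|k IH]; first by rewrite expr0 trmx1.
by rewrite {1}exprS -mulmxE trmx_mul IH sA mulmxE exprSr.
Qed.

(* The norms of [x A^j] are log-convex in [j], so the norm of [x A] is
   controlled by that of [x A^k]. *)
Lemma qf_trace_pow n (A : 'M[R]_n) k d : A^T = A -> (0 < k)%N -> 0 <= d ->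
  \tr (A ^+ (2 * k)) <= d ^+ (2 * k) ->
  forall x, `|qf A x| <= d * qf 1%:M x.
Proof.
move=> sA k0 d0 trA x; pose a j := qf 1%:M (x *m A ^+ j).
have a_ge0 j : 0 <= a j by exact: qf1_ge0.
have aS j : a j.+1 ^+ 2 <= a j * a j.+2.
  have -> : a j.+1 = dot (x *m A ^+ j) (x *m A ^+ j.+2).
    by rewrite /a -dotxx {1}exprSr -mulmxE mulmxA dot_mulmx sA -mulmxA mulmxE -exprSr.
  exact: cauchy_schwarz.
(* By log-convexity the ratios [a j.+1 / a j] increase, so the first is the smallest; the products
   avoid dividing by a vanishing norm. *)
have a1 j : a 1%N * a j <= a 0%N * a j.+1.
  elim: j => [|j IH]; first by rewrite mulrC.
  have [aj0|ajn0] := eqVneq (a j.+1) 0; first by rewrite aj0 mulr0 mulr_ge0.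
  have aj1 : 0 < a j.+1 by rewrite lt_def ajn0 a_ge0.
  rewrite -(ler_pM2r aj1).
  have h1 := ler_wpM2l (a_ge0 1%N) (aS j); have h2 := ler_wpM2r (a_ge0 j.+2) IH.
  apply: le_trans (_ : a 1%N * (a j * a j.+2) <= _); first by rewrite -mulrA -expr2.
  by rewrite mulrA (le_trans h2) // -!mulrA (mulrC (a j.+1)).
have a1k j : a 1%N ^+ j.+1 <= a 0%N ^+ j * a j.+1.
  elim: j => [|j IH]; first by rewrite expr1 expr0 mul1r.
  rewrite exprS; apply: le_trans (ler_wpM2l (a_ge0 1%N) IH) _.
  by rewrite mulrCA exprSr -mulrA ler_wpM2l ?exprn_ge0 ?a1.
have ak : a k <= d ^+ (2 * k) * a 0%N.
  apply: le_trans (qf1_mulmx_frobenius _ _) _.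
  rewrite /a expr0 mulmx1 ler_wpM2r ?qf1_ge0 //.
  by rewrite trmxX // mulmxE -exprD addnn -mul2n.
have a01 : a 1%N ^+ k <= d ^+ (2 * k) * a 0%N ^+ k.
  case: k k0 ak {trA} => // k _ ak; apply: le_trans (a1k k) _.
  by rewrite [a 0%N ^+ k.+1]exprSr mulrCA ler_wpM2l ?exprn_ge0.
have qa : qf A x ^+ 2 <= a 0%N * a 1%N.
  have -> : qf A x = dot (x *m A) x by [].
  by rewrite mulrC /a expr1 expr0 mulmx1; exact: cauchy_schwarz.
have x1 : qf 1%:M x = a 0%N by rewrite /a expr0 mulmx1.
rewrite x1; have k2 : (0 < 2 * k)%N by rewrite muln_gt0.
rewrite -(ler_pXn2r k2) ?nnegrE ?mulr_ge0 //.
rewrite exprM real_normK ?num_real //.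
apply: le_trans (_ : (a 0%N * a 1%N) ^+ k <= _).
  
by apply: lerXn2r; rewrite ?nnegrE ?sqr_ge0 ?mulr_ge0.
rewrite !exprMn (mulnC 2 k) [a 0%N ^+ (k * 2)]exprM expr2 mulrCA ler_wpM2l ?exprn_ge0 //.
by rewrite mulnC.
Qed.

(** Each diagonal entry of [A ^+ (2 * k)] is the squared norm of a row of [A ^+ k], controlled by
    applying the norm bound [k] times to a basis vector. *)
Lemma trace_pow_le n (A : 'M[R]_n) k M : A^T = A -> 0 <= M ->
  (forall x, qf 1%:M (x *m A) <= M ^+ 2 * qf 1%:M x) ->
  \tr (A ^+ (2 * k)) <= n%:R * M ^+ (2 * k).
Proof.
move=> sA M0 HM.
have HMk x : qf 1%:M (x *m A ^+ k) <= M ^+ (2 * k) * qf 1%:M x.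
  elim: k x => [|k IH] x; first by rewrite expr0 mulmx1 muln0 expr0 mul1r.
  rewrite exprSr -mulmxE mulmxA; apply: le_trans (HM _) _.
  by rewrite mulnS exprD -mulrA ler_wpM2l ?exprn_ge0.
have -> : A ^+ (2 * k) = A ^+ k *m (A ^+ k)^T by rewrite trmxX // mulmxE -exprD addnn mul2n.
apply: (@le_trans _ _ (\sum_(i < n) M ^+ (2 * k))); last first.
  by rewrite sumr_const card_ord mulr_natl.
apply: ler_sum => i _; have := HMk (delta_mx 0 i).
rewrite -rowE; have -> : qf 1%:M (delta_mx 0 i : 'rV[R]_n) = 1.
  rewrite qf1E (bigD1 i) //= mxE !eqxx expr1n big1 ?addr0 // => j /negPf ji.
  by rewrite mxE ji andbF expr0n.
rewrite mulr1; apply: le_trans; rewrite mxE qf1E.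
by apply: ler_sum => j _; rewrite !mxE expr2.
Qed.

End Norms.

Section Net.
Variable R : realType.

(* Integers are coded by sign and magnitude; the two codes of 0 are harmless,
   as only upper bounds on the number of codes are needed. *)
Definition lattice_val B (e : bool * 'I_B) : R := (-1) ^+ e.1 * e.2%:R.

(** Keeping the sign of [a], its magnitude is rounded up or down, whichever does not decrease
    [a * v]. *)
Lemma lattice_round (a v : R) B : `|a| + 1 < B%:R ->
  exists e : bool * 'I_B, a * v <= lattice_val e * v /\ e.2%:R <= `|a| + 1.
Proof.
move=> aB; pose k := Num.truncn `|a|.
have /andP[ka ak] : k%:R <= `|a| < k.+1%:R by apply: truncn_itv.
have k1B : (k.+1 < B)%N.
  by rewrite -(ltr_nat R); apply: le_lt_trans aB; rewrite -natr1 lerD2r.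
have kB : (k < B)%N := ltnW k1B.
have aE := realEsign (num_real a).
set sg : R := (-1) ^+ (a < 0)%R in aE.
case: (leP 0 (sg * v)) => sv.
  exists ((a < 0)%R, Ordinal k1B); split; last by rewrite /= -natr1 lerD2r.
  rewrite /lattice_val /= -/sg {1}aE ![sg * _ * v]mulrAC ler_wpM2l // ltW //.
exists ((a < 0)%R, Ordinal kB); split; last by rewrite /= (le_trans ka) // lerDl.
by rewrite /lattice_val /= -/sg {1}aE ![sg * _ * v]mulrAC ler_wnM2l // ltW.
Qed.

Variable m : nat.
Local Notation lattice := {ffun 'I_m -> bool * 'I_m.+2}.

Definition lattice_row (z : lattice) : 'rV[R]_m := \row_i lattice_val (z i).
(* Contains all coordinatewise roundings of vectors of squared norm at most [m]. *)
Definition net : {pred lattice} := fun z =>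
  (\sum_i (z i).2 <= 2 * m)%N && (\sum_i (z i).2 ^ 2 <= 4 * m)%N.

Lemma qf1_net z : z \in net -> qf 1%:M (lattice_row z) <= (4 * m)%:R.
Proof.
case/andP => _ z2; rewrite qf1E -(ler_nat R) in z2 *.
apply: le_trans z2; rewrite natr_sum; apply: ler_sum => i _.
by rewrite mxE /lattice_val exprMn sqrr_sign mul1r natrX.
Qed.

(** Each coordinate is rounded in the direction favoured by [v], so passing to the net loses nothing
    in the linear form and leaves no approximation error to absorb. *)
Lemma net_round (x v : 'rV[R]_m) : qf 1%:M x <= m%:R ->
  exists2 z, z \in net & dot x v <= dot (lattice_row z) v.
Proof.
rewrite qf1E => xm.
have xB i : `|x 0 i| + 1 < m.+2%:R.
  have xi : x 0 i ^+ 2 <= m%:R.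
    apply: le_trans xm; rewrite (bigD1 i) //= lerDl sumr_ge0 // => j _; exact: sqr_ge0.
  have m1 : 1 <= m%:R :> R by rewrite ler1n (leq_ltn_trans _ (ltn_ord i)).
  have : `|x 0 i| <= m%:R.
    rewrite -(@ler_pXn2r _ 2) ?nnegrE ?ler0n // real_normK ?num_real //.
    by apply: le_trans xi _; rewrite expr2 ler_peMl.
  by rewrite -!natr1; lra.
have [f Hf] := fin_all_exists (fun i => lattice_round (v 0 i) (xB i)).
exists (finfun f); last first.
  rewrite !dotE; apply: ler_sum => i _; rewrite mxE ffunE; exact: (Hf i).1.
have bnd i : ((f i).2%:R : R) <= `|x 0 i| + 1 := (Hf i).2.
have amgm i : `|x 0 i| <= (1 + x 0 i ^+ 2) / 2.
  rewrite -[x 0 i ^+ 2]real_normK ?num_real //.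
  have := sqr_ge0 (`|x 0 i| - 1); lra.
have s1 : \sum_(i < m) (1 : R) = m%:R by rewrite sumr_const card_ord.
(* [|x| + 1 <= 3/2 + x^2 / 2] and [(|x| + 1)^2 <= 2 + 2 x^2] sum to the two thresholds [2 * m] and
   [4 * m] of [net]. *)
apply/andP; split; rewrite -(ler_nat R) natr_sum natrM.
  apply: (@le_trans _ _ (\sum_i ((3 / 2) * 1 + 2^-1 * x 0 i ^+ 2))).
    apply: ler_sum => i _; rewrite ffunE; apply: le_trans (bnd i) _.
    have := amgm i; lra.
  by rewrite big_split /= -!mulr_sumr s1; lra.
apply: (@le_trans _ _ (\sum_i (2 * 1 + 2 * x 0 i ^+ 2))).
  apply: ler_sum => i _; rewrite ffunE natrX.
  apply: (@le_trans _ _ ((`|x 0 i| + 1) ^+ 2)).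
    by apply: lerXn2r; rewrite ?nnegrE ?addr_ge0 ?ler0n.
  rewrite -[x 0 i ^+ 2]real_normK ?num_real //.
  have := sqr_ge0 (`|x 0 i| - 1); lra.
by rewrite big_split /= -!mulr_sumr s1; lra.
Qed.

Definition net_form (Y : 'M[R]_m) (e : lattice * lattice) : R :=
  dot (lattice_row e.1 *m Y) (lattice_row e.2).

Definition net_norm (Y : 'M[R]_m) : R :=
  \big[Num.max/0]_(e : lattice * lattice | (e.1 \in net) && (e.2 \in net)) net_form Y e.

Lemma net_norm_ge0 Y : 0 <= net_norm Y.
Proof. exact: bigmax_ge_id. Qed.

Lemma net_normP Y x y : qf 1%:M x <= m%:R -> qf 1%:M y <= m%:R ->
  dot (x *m Y) y <= net_norm Y.
Proof.
move=> xm ym; rewrite dot_mulmx.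
have [z zn le1] := net_round (y *m Y^T) xm; apply: le_trans le1 _.
have [z' zn' le2] := net_round (lattice_row z *m Y) ym.
rewrite -dot_mulmx dotC; apply: le_trans le2 _.
rewrite dotC -[dot _ _]/(net_form Y (z, z')).
by apply: le_bigmax_cond; rewrite /= zn zn'.
Qed.

Lemma net_norm_pow Y k : (0 < k)%N ->
  net_norm Y ^+ (2 * k) <=
  \sum_(e : lattice * lattice | (e.1 \in net) && (e.2 \in net)) net_form Y e ^+ (2 * k).
Proof.
move=> k0; have ev (a : R) : 0 <= a ^+ (2 * k) by rewrite exprM exprn_ge0 ?sqr_ge0.
rewrite /net_norm; elim/big_rec2: _ => [|e a b _ ba]; first by rewrite expr0n muln_eq0 /= (gtn_eqF k0).
case: (leP (net_form Y e) b) => _; first by rewrite (le_trans ba) // lerDr.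
by rewrite lerDl (le_trans _ ba).
Qed.

(** Testing the form on [x] and [x *m Y], both rescaled to squared norm [m], bounds the operator
    norm of [Y] by [net_norm Y / m]; an even power of the maximum is then at most the sum of the
    powers. *)
Lemma trace_net (Y : 'M[R]_m) k : (0 < m)%N -> (0 < k)%N -> Y^T = Y ->
  \tr (Y ^+ (2 * k)) <= m%:R / m%:R ^+ (2 * k) *
  \sum_(e : lattice * lattice | (e.1 \in net) && (e.2 \in net)) net_form Y e ^+ (2 * k).
Proof.
move=> m0 k0 sY; have mR : 0 < m%:R :> R by rewrite ltr0n.
apply: (@le_trans _ _ (m%:R * (net_norm Y / m%:R) ^+ (2 * k))); last first.
  by rewrite expr_div_n mulrCA [leLHS]mulrC ler_wpM2l ?net_norm_pow.
apply: trace_pow_le => //; first by rewrite divr_ge0 ?net_norm_ge0 ?ler0n.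
move=> x; set a := qf 1%:M x; set b := qf 1%:M _.
have a0 : 0 <= a := qf1_ge0 _; have b0 : 0 <= b := qf1_ge0 _.
have [a_eq|an0] := eqVneq a 0.
  by rewrite a_eq /b (qf1_eq0 a_eq) mul0mx qf0 mulr0.
have [->|bn0] := eqVneq b 0; first by rewrite mulr_ge0 ?sqr_ge0.
have agt : 0 < a by rewrite lt_def an0.
have bgt : 0 < b by rewrite lt_def bn0.
have := @net_normP Y (Num.sqrt (m%:R / a) *: x) (Num.sqrt (m%:R / b) *: (x *m Y)).
rewrite !qf1Z -/a -/b !sqr_sqrtr ?divr_ge0 ?ler0n // !divfK // lexx => /(_ isT isT).
rewrite -scalemxAl dotZl dotC dotZl dotxx -/b => h.
have ge0 : 0 <= Num.sqrt (m%:R / a) * (Num.sqrt (m%:R / b) * b).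
  by rewrite !mulr_ge0 ?sqrtr_ge0.
have := lerXn2r 2 ge0 (net_norm_ge0 Y) h.
rewrite !exprMn !sqr_sqrtr ?divr_ge0 ?ler0n //.
have -> : m%:R / a * (m%:R / b * b ^+ 2) = m%:R ^+ 2 * b / a by field; rewrite an0 bn0.
rewrite ler_pdivrMr // => h2; rewrite exprVn mulrAC ler_pdivlMr ?exprn_gt0 //.
by rewrite mulrC.
Qed.

(** Exponential weighting: the factors [4 * 2 ^- (z i).2] multiply to at least 1 on the net, where
    the magnitudes sum to at most [2 * m], while the total over all codes factors into [m] geometric
    sums, each below 16. *)
Lemma card_net : #|net|%:R <= 16 ^+ m :> R.
Proof.
apply: (@le_trans _ _ (\sum_(z : lattice) \prod_i (4 * 2 ^- (z i).2))).
  rewrite -sum1_card natr_sum [leLHS]big_mkcond; apply: ler_sum => z _.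
  case: ifP => [/andP[z1 _]|_]; last first.
    by apply: prodr_ge0 => i _; rewrite mulr_ge0 // invr_ge0 exprn_ge0.
  rewrite big_split /= prodr_const card_ord prodfV -expr_sum.
  rewrite ler_pdivlMr ?exprn_gt0 // mul1r (_ : 4 = 2 ^+ 2) -?exprM.
    by rewrite ler_eXn2l ?ltr1n.
  by rewrite expr2; lra.
rewrite -(bigA_distr_bigA (fun _ (e : bool * 'I_m.+2) => 4 * 2 ^- e.2)) prodr_const card_ord.
have geo (B : nat) : \sum_(j < B) 2 ^- j = 2 - 2 * 2 ^- B :> R.
  elim: B => [|B IH]; first by rewrite big_ord0 expr0; lra.
  rewrite big_ord_recr /= IH exprS; field.
  by rewrite expf_neq0 // pnatr_eq0.
apply: lerXn2r; rewrite ?nnegrE ?sumr_ge0 //.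
rewrite -(pair_bigA _ (fun _ (j : 'I_m.+2) => 4 * 2 ^- j)) /= big_bool /= -mulr_sumr geo.
have : 0 < 2 ^- m.+2 :> R by rewrite invr_gt0 exprn_gt0.
lra.
Qed.

End Net.

(** * The dense comparison matrix *)

Section Exponentials.
Variable R : realType.

Lemma expR_le_quadratic (x : R) : x <= 1 / 2 -> expR x <= 1 + x + 2 * x ^+ 2.
Proof.
move=> x2; have x1 : 0 < 1 - x by lra.
have : 1 - x <= expR (- x) by apply: expR_ge1Dx.
rewrite -(lef_pV2 _ _) ?posrE ?expR_gt0 // -expRN opprK => /le_trans; apply.
rewrite -[leLHS]mul1r ler_pdivrMr //.
have := sqr_ge0 x; nra.
Qed.

(** The variable is 2 with probability 1/3 and -1 otherwise, hence centered: for [|t| <= 1/4] the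
    linear terms cancel, and beyond that both exponents are at most [8 * t ^+ 2]. *)
Lemma mgf_le (t : R) :
  3^-1 * expR (2 * t) + (1 - 3^-1) * expR (- t) <= expR (8 * t ^+ 2).
Proof.
case: (leP `|t| (1 / 4)) => t4.
  have /andP[t1 t2] : - (1 / 4) <= t <= 1 / 4 by rewrite -ler_norml.
  have h1 : expR (2 * t) <= 1 + 2 * t + 2 * (2 * t) ^+ 2 by apply: expR_le_quadratic; lra.
  have h2 : expR (- t) <= 1 + - t + 2 * (- t) ^+ 2 by apply: expR_le_quadratic; lra.
  apply: le_trans (expR_ge1Dx _); have := sqr_ge0 t; lra.
have t2 : 2 * `|t| <= 8 * t ^+ 2.
  rewrite -[t ^+ 2]real_normK ?num_real // expr2; nra.
have h1 : expR (2 * t) <= expR (8 * t ^+ 2).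
  by rewrite ler_expR (le_trans _ t2) // ler_wpM2l // ler_norm.
have h2 : expR (- t) <= expR (8 * t ^+ 2).
  rewrite ler_expR (le_trans _ t2) //; have := ler_norm (- t); rewrite normrN.
  have := normr_ge0 t; lra.
lra.
Qed.

(** Raise [|x| / (2 k) <= expR (|x| / (2 k))] to the power [2 k]. *)
Lemma even_power_le_expR (x : R) k : (0 < k)%N ->
  x ^+ (2 * k) <= (2 * k)%:R ^+ (2 * k) * (expR x + expR (- x)).
Proof.
move=> k0; have k2 : 0 < (2 * k)%:R :> R by rewrite ltr0n muln_gt0.
have -> : x ^+ (2 * k) = `|x| ^+ (2 * k) by rewrite !exprM real_normK ?num_real.
have h : `|x| <= (2 * k)%:R * expR (`|x| / (2 * k)%:R).
  rewrite -ler_pdivrMl // mulrC; apply: le_trans (expR_ge1Dx _); lra.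
apply: (@le_trans _ _ ((2 * k)%:R ^+ (2 * k) * expR `|x|)).
  apply: le_trans (_ : ((2 * k)%:R * expR (`|x| / (2 * k)%:R)) ^+ (2 * k) <= _).
    by apply: lerXn2r; rewrite ?nnegrE ?mulr_ge0 ?expR_ge0 // ltW.
  by rewrite exprMn -expRM_natl mulrCA mulfV ?mulr1 ?gt_eqF.
rewrite ler_wpM2l ?exprn_ge0 ?(ltW k2) //.
have := expR_ge0 x; have := expR_ge0 (- x); case: (ger0P x) => _; lra.
Qed.

End Exponentials.

Lemma sum_lt_pairs (V : zmodType) m (F : 'I_m -> 'I_m -> V) :
  (forall i, F i i = 0) ->
  \sum_i \sum_j F i j =
  \sum_(i : 'I_m) \sum_(j : 'I_m) (if (i < j)%N then F i j + F j i else 0).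
Proof.
move=> F0.
transitivity (\sum_(i : 'I_m) \sum_(j : 'I_m) (if (i < j)%N then F i j else 0) +
              \sum_(i : 'I_m) \sum_(j : 'I_m) (if (j < i)%N then F i j else 0)).
  rewrite -big_split; apply: eq_bigr => i _; rewrite -big_split; apply: eq_bigr => j _ /=.
  case: (ltngtP i j) => [||/val_inj ->]; rewrite ?addr0 ?add0r //; exact: F0.
rewrite [X in _ + X]exchange_big -big_split; apply: eq_bigr => i _.
rewrite -big_split; apply: eq_bigr => j _ /=.
by case: ifP => _; rewrite ?addr0.
Qed.

Section DenseModel.
Variables (R : realType) (m : nat).
Local Notation P := (fun _ _ : 'I_m => 3^-1 : R).
Local Notation lattice := {ffun 'I_m -> bool * 'I_m.+2}.

Definition dense (y : sample m) : 'M[R]_m := 3 *: centered P y.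

Lemma dense_sym y : (dense y)^T = dense y.
Proof. by rewrite /dense linearZ /= centered_sym. Qed.

Lemma dense_weight_ge0 (y : sample m) : 0 <= bern_weight P y.
Proof. apply: bern_weight_ge0 => i j; apply/andP; split; lra. Qed.

Lemma dense_form (a b : 'rV[R]_m) y : dot (a *m dense y) b =
  \sum_(i : 'I_m) \sum_(j : 'I_m) (if (i < j)%N
    then (a 0 i * b 0 j + a 0 j * b 0 i) * (3 * ((y i j)%:R - 3^-1)) else 0).
Proof.
have -> : dot (a *m dense y) b = \sum_i \sum_j a 0 i * dense y i j * b 0 j.
  rewrite dotE exchange_big; apply: eq_bigr => j _; rewrite mxE mulr_suml.
  by apply: eq_bigr => i _.
rewrite sum_lt_pairs => [|i]; last by rewrite !mxE eqxx !(mulr0, mul0r).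
apply: eq_bigr => i _; apply: eq_bigr => j _; case: ifP => // ij.
have -> : dense y j i = dense y i j by rewrite -[in LHS]dense_sym mxE.
rewrite !mxE /edge ij /= ifN; first by ring.
by apply: contraTneq ij => ->; rewrite ltnn.
Qed.

Lemma expect_exp_form (a b : 'rV[R]_m) t :
  \sum_y bern_weight P y * expR (t * dot (a *m dense y) b) <=
  expR (32 * t ^+ 2 * (qf 1%:M a * qf 1%:M b)).
Proof.
pose c i j := a 0 i * b 0 j + a 0 j * b 0 i.
pose g i j (e : bool) := expR (t * c i j * (3 * (e%:R - 3^-1))).
have -> : \sum_y bern_weight P y * expR (t * dot (a *m dense y) b) =
    \prod_(i : 'I_m) \prod_(j : 'I_m) (if (i < j)%N then
       3^-1 * g i j true + (1 - 3^-1) * g i j false else 1).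
  rewrite -(expect_prod P); apply: eq_bigr => y _; congr (_ * _).
  rewrite dense_form mulr_sumr expR_sum; apply: eq_bigr => i _.
  rewrite mulr_sumr expR_sum; apply: eq_bigr => j _.
  by case: ifP => _; rewrite /g ?mulr0 ?expR0 // mulrA.
(* Bounding the trivial factors [i >= j] as well completes the product to all ordered pairs, whose
   exponents sum to [32 t^2] times the product of the squared norms. *)
apply: (@le_trans _ _ (\prod_(i : 'I_m) \prod_(j : 'I_m)
    expR (16 * t ^+ 2 * (a 0 i ^+ 2 * b 0 j ^+ 2 + a 0 j ^+ 2 * b 0 i ^+ 2)))).
  have g0 i j : 0 <= 3^-1 * g i j true + (1 - 3^-1) * g i j false.
    by rewrite addr_ge0 // mulr_ge0 ?expR_ge0 //; lra.
  apply: ler_prod => i _; apply/andP; split.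
    by apply: prodr_ge0 => j _; case: ifP => _; [exact: g0|exact: ler01].
  apply: ler_prod => j _; apply/andP; split.
    by case: ifP => _; [exact: g0|exact: ler01].
  have pos : 0 <= 16 * t ^+ 2 * (a 0 i ^+ 2 * b 0 j ^+ 2 + a 0 j ^+ 2 * b 0 i ^+ 2).
    apply: mulr_ge0; first by apply: mulr_ge0; rewrite ?sqr_ge0.
    by apply: addr_ge0; apply: mulr_ge0; apply: sqr_ge0.
  case: ifP => _; last by apply: le_trans (expR_ge1Dx _); rewrite lerDl.
  have -> : g i j true = expR (2 * (t * c i j)) by congr expR; rewrite /=; field.
  have -> : g i j false = expR (- (t * c i j)) by congr expR; rewrite /=; field.
  apply: le_trans (mgf_le _) _; rewrite ler_expR exprMn mulrA.
  have : c i j ^+ 2 <= 2 * (a 0 i ^+ 2 * b 0 j ^+ 2 + a 0 j ^+ 2 * b 0 i ^+ 2).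
    rewrite /c -subr_ge0.
    have := sqr_ge0 (a 0 i * b 0 j - a 0 j * b 0 i); congr (_ <= _); ring.
  have t8 : 0 <= 8 * t ^+ 2 by rewrite mulr_ge0 ?sqr_ge0.
  move/(ler_wpM2l t8) => h; apply: le_trans h _.
  by rewrite le_eqVlt; apply/orP; left; apply/eqP; ring.
rewrite le_eqVlt; apply/orP; left; apply/eqP.
under eq_bigr do rewrite -expR_sum -mulr_sumr.
rewrite -expR_sum -mulr_sumr; congr expR.
under eq_bigr do rewrite big_split.
rewrite big_split /= [X in _ + X]exchange_big /= !qf1E big_distrlr /=; ring.
Qed.

Lemma expect_net_form (e : lattice * lattice) k : (0 < m)%N -> (0 < k)%N ->
  (e.1 \in @net m) && (e.2 \in @net m) ->
  \sum_y bern_weight P y * net_form (dense y) e ^+ (2 * k) <=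
  m%:R ^+ k * (2 * k)%:R ^+ (2 * k) * (2 * expR (512 * m%:R)).
Proof.
move=> m0 k0 /andP[/(@qf1_net R) n1 /(@qf1_net R) n2].
have mR : 0 < m%:R :> R by rewrite ltr0n.
(* This scale makes the exponent [32 t^2 (4 m)^2 = 512 m] linear in [m], like the bound on the
   logarithm of the net size. *)
pose t : R := (Num.sqrt m%:R)^-1.
have t2 : t ^+ 2 = m%:R^-1 by rewrite exprVn sqr_sqrtr // ltW.
have bound s : s ^+ 2 = m%:R^-1 ->
    \sum_y bern_weight P y * expR (s * net_form (dense y) e) <= expR (512 * m%:R).
  move=> s2; apply: le_trans (expect_exp_form _ _ _) _; rewrite ler_expR s2.
  apply: (@le_trans _ _ (32 / m%:R * ((4 * m)%:R * (4 * m)%:R))).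
    rewrite ler_wpM2l ?divr_ge0 ?(ltW mR) //.
    by rewrite ler_pM ?qf1_ge0.
  rewrite natrM le_eqVlt; apply/orP; left; apply/eqP; field; by rewrite gt_eqF.
apply: (@le_trans _ _ (\sum_y m%:R ^+ k * (2 * k)%:R ^+ (2 * k) *
   (bern_weight P y * expR (t * net_form (dense y) e) +
    bern_weight P y * expR (- t * net_form (dense y) e)))).
  apply: ler_sum => y _; set f := net_form _ _.
  have -> : f ^+ (2 * k) = m%:R ^+ k * (t * f) ^+ (2 * k).
    rewrite [(t * f) ^+ _]exprMn [t ^+ (2 * k)]exprM t2 mulrA -exprMn mulfV ?gt_eqF //.
    by rewrite expr1n mul1r.
  have c0 : 0 <= m%:R ^+ k * bern_weight P y.
    by rewrite mulr_ge0 ?dense_weight_ge0 ?exprn_ge0 ?(ltW mR).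
  have := ler_wpM2l c0 (even_power_le_expR (t * f) k0); rewrite mulNr.
  rewrite -mulrDr [m%:R ^+ k * bern_weight _ _]mulrC -!mulrA => /le_trans; apply.
  by rewrite le_eqVlt; apply/orP; left; apply/eqP; rewrite mulrCA; congr (_ * _); exact: mulrCA.
rewrite -mulr_sumr ler_wpM2l ?mulr_ge0 ?exprn_ge0 ?ler0n // big_split /=.
have h1 := bound t t2; have := bound (- t); rewrite sqrrN => /(_ t2) h2; lra.
Qed.

(** The union bound over at most [256 ^ m] pairs costs only a factor exponential in [m], harmless
    when [m] is proportional to [k]. *)
Lemma expect_trace_dense k : (0 < m)%N -> (0 < k)%N ->
  \sum_y bern_weight P y * \tr (dense y ^+ (2 * k)) <=
  2 * m%:R * ((2 * k)%:R ^+ 2 / m%:R) ^+ k * (256 * expR 512) ^+ m.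
Proof.
move=> m0 k0; have mR : 0 < m%:R :> R by rewrite ltr0n.
pose N (e : lattice * lattice) :=
  (e.1 \in @net m) && (e.2 \in @net m).
apply: (@le_trans _ _ (\sum_y bern_weight P y * (m%:R / m%:R ^+ (2 * k) *
    \sum_(e | N e) net_form (dense y) e ^+ (2 * k)))).
  by apply: ler_sum => y _; rewrite ler_wpM2l ?dense_weight_ge0 ?trace_net ?dense_sym.
set B := m%:R ^+ k * (2 * k)%:R ^+ (2 * k) * (2 * expR (512 * m%:R)) : R.
have B0 : 0 <= B by rewrite !mulr_ge0 ?exprn_ge0 ?ler0n ?expR_ge0.
apply: (@le_trans _ _ (m%:R / m%:R ^+ (2 * k) * \sum_(e | N e) B)).
  under eq_bigr do rewrite mulrCA.
  rewrite -mulr_sumr ler_wpM2l ?divr_ge0 ?exprn_ge0 ?ler0n //.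
  under eq_bigr do rewrite mulr_sumr.
  rewrite exchange_big; apply: ler_sum => e Ne; exact: expect_net_form.
have -> : \sum_(e | N e) B = #|@net m|%:R * #|@net m|%:R * B.
  rewrite -(pair_big (mem (@net m)) (mem (@net m)) (fun _ _ => B)) /=.
  by under eq_bigr do rewrite sumr_const; rewrite sumr_const -[LHS]mulr_natl -[B *+ _]mulr_natl mulrA.
have nn : #|@net m|%:R * #|@net m|%:R <= 256 ^+ m :> R.
  rewrite (_ : 256 = 16 * 16) ?exprMn; last by ring.
  by rewrite ler_pM ?ler0n ?card_net.
apply: (@le_trans _ _ (m%:R / m%:R ^+ (2 * k) * (256 ^+ m * B))).
  by rewrite ler_wpM2l ?divr_ge0 ?exprn_ge0 ?ler0n // ler_wpM2r.
have eE : expR (512 * m%:R) = expR 512 ^+ m :> R by rewrite mulrC expRM_natl.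
rewrite /B eE [(256 * _) ^+ m]exprMn expr_div_n -[((2 * k)%:R ^+ 2) ^+ k]exprM.
rewrite le_eqVlt; apply/orP; left; apply/eqP.
have -> : m%:R ^+ (2 * k) = m%:R ^+ k * m%:R ^+ k :> R by rewrite mul2n -addnn exprD.
field.
by rewrite expf_neq0 // gt_eqF.
Qed.

End DenseModel.

(** * Concentration of the adjacency matrix *)

Section Concentration.
Variable R : realType.

Let net_const_gt0 : 0 < 256 * expR 512 :> R.
Proof. by apply: mulr_gt0; [rewrite ltr0n|exact: expR_gt0]. Qed.

(** The cube comes from [m = 3 k]; the factor 2 is room for [4 / 3 = (2 k)^2 / (3 k^2)]. *)
Definition dense_const : R := 2 * (256 * expR 512) ^+ 3.

Lemma dense_const_gt0 : 0 < dense_const.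
Proof. by apply: mulr_gt0; rewrite ?ltr0n //; apply: exprn_gt0. Qed.

Lemma expect_trace_bound n k (P : 'I_n -> 'I_n -> R) :
  (0 < k <= n)%N -> (forall i j, 0 <= P i j <= 1) ->
  (forall i j, P i j * (1 - P i j) <= k%:R / n%:R) ->
  \sum_x bern_weight P x * \tr (centered P x ^+ (2 * k)) <=
  6 * n%:R * (dense_const * k%:R) ^+ k.
Proof.
move=> /andP[k0 kn] P01 Pt; have n0 : (0 < n)%N := leq_trans k0 kn.
have kR : 0 < k%:R :> R by rewrite ltr0n.
have nR : 0 < n%:R :> R by rewrite ltr0n.
have t01 : 0 <= (k%:R / n%:R : R) <= 1.
  by rewrite divr_ge0 ?ler0n //= ler_pdivrMr // mul1r ler_nat.
apply: le_trans (expect_trace_le _ P01 Pt t01) _.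
(* The walks have length [2 k], so [3 k] is the least number of vertices that the comparison
   admits. *)
apply: le_trans (@good_comparison R n (3 * k) (2 * k) k n0 k0 _) _; first lia.
apply: (@le_trans _ _ (n%:R / k%:R * (6 * k%:R * (dense_const * k%:R) ^+ k))); last first.
  by rewrite le_eqVlt; apply/orP; left; apply/eqP; field; rewrite gt_eqF.
rewrite ler_wpM2l ?divr_ge0 ?ler0n //.
apply: le_trans (card_good_le _ _ _) _.
have m0 : (0 < 3 * k)%N by rewrite muln_gt0.
apply: le_trans (expect_trace_dense R m0 k0) _.
have -> : (2 * k)%:R ^+ 2 / (3 * k)%:R = 4 / 3 * k%:R :> R.
  by rewrite !natrM; field; rewrite gt_eqF.
have -> : (dense_const * k%:R) ^+ k = (2 * k%:R) ^+ k * ((256 * expR 512) ^+ 3) ^+ k :> R.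
  by rewrite -exprMn /dense_const mulrAC.
rewrite [(256 * expR 512) ^+ (3 * k)]exprM mulrA.
rewrite ler_wpM2r ?exprn_ge0 ?(ltW net_const_gt0) //.
rewrite natrM mulrA (_ : 2 * 3 = 6); last by ring.
rewrite ler_wpM2l ?mulr_ge0 ?ler0n //.
by apply: lerXn2r; rewrite ?nnegrE ?mulr_ge0 ?ler0n // ler_wpM2r ?ler0n //; lra.
Qed.

Lemma trace_even_ge0 n (A : 'M[R]_n) k : A^T = A -> 0 <= \tr (A ^+ (2 * k)).
Proof.
move=> sA; rewrite mul2n -addnn exprD -{2}(trmxX k sA) -mulmxE.
apply: sumr_ge0 => i _; rewrite mxE; apply: sumr_ge0 => j _.
by rewrite !mxE -expr2 sqr_ge0.
Qed.

(** Markov's inequality: outside [E] the nonnegative trace is at least the [2 k]-th power of the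
    radius, by [qf_trace_pow], and the factor [expR 1] inside the radius yields [expR (- k)]. *)
Lemma norm_concentration n k (P : 'I_n -> 'I_n -> R) (E : sample n -> Prop) :
  (0 < k <= n)%N -> (forall i j, 0 <= P i j <= 1) ->
  (forall i j, P i j * (1 - P i j) <= k%:R / n%:R) ->
  (forall x, (forall v, `|qf (centered P x) v| <=
      Num.sqrt (expR 1 * (dense_const * k%:R)) * qf 1%:M v) -> E x) ->
  1 - 6 * n%:R * expR (- k%:R) <= \sum_(x | `[< E x >]) bern_weight P x.
Proof.
move=> k0n P01 Pt HE; have /andP[k0 kn] := k0n.
set d2 := expR 1 * (dense_const * k%:R) in HE.
have Dk : 0 < dense_const * k%:R by rewrite mulr_gt0 ?dense_const_gt0 ?ltr0n.
have d20 : 0 < d2 by rewrite mulr_gt0 ?expR_gt0.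
rewrite -[X in X - _](bern_weight_sum1 P) (bigID (fun x => `[< E x >])) /= lerBlDr lerD2l.
apply: (@le_trans _ _ ((\sum_x bern_weight P x * \tr (centered P x ^+ (2 * k))) / d2 ^+ k)).
  rewrite mulr_suml big_mkcond /=; apply: ler_sum => x _.
  have w0 := bern_weight_ge0 x P01.
  have tr0 := trace_even_ge0 k (centered_sym P x).
  case: asboolP => Ex /=.
    by rewrite divr_ge0 ?mulr_ge0 ?exprn_ge0 // ltW.
  rewrite -mulrA ler_peMr // ler_pdivlMr ?exprn_gt0 // mul1r leNgt; apply/negP => trlt.
  apply: Ex; apply: HE; apply: (qf_trace_pow (centered_sym P x) k0); rewrite ?sqrtr_ge0 //.
  by rewrite [leRHS]exprM sqr_sqrtr ltW.
rewrite ler_pdivrMr ?exprn_gt0 //.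
apply: le_trans (expect_trace_bound k0n P01 Pt) _.
have -> : d2 ^+ k = expR k%:R * (dense_const * k%:R) ^+ k.
  by rewrite /d2 exprMn -expRM_natl mulr1.
by rewrite mulrA -[_ * expR k%:R]mulrA -expRD addNr expR0 mulr1.
Qed.

End Concentration.

(** * Elementary inequalities and the centered adjacency matrix *)

Section MainBounds.
Variable R : realType.

(** [p - q] is at most both [p] and [1 - q], and one of these two is at least 1/2, which makes the
    other at most [2 p (1 - q)]. *)
Lemma separation_variance (p q : R) : 0 <= q -> q < p -> p <= 1 ->
  (p - q) ^+ 2 <= p * (1 - q) /\ (p - q) ^+ 2 <= 4 * (p * (1 - q)) ^+ 2.
Proof.
move=> q0 qp p1; have h1 : 0 <= p - q by lra.
have h2 : p - q <= p by lra.
have h3 : p - q <= 1 - q by lra.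
split; first by rewrite expr2 ler_pM.
have [ple|plt] := leP (1 / 2) p.
  apply: (@le_trans _ _ ((2 * (p * (1 - q))) ^+ 2)); last by rewrite exprMn; lra.
  by apply: lerXn2r; rewrite ?nnegrE ?mulr_ge0 //; nra.
apply: (@le_trans _ _ ((2 * (p * (1 - q))) ^+ 2)); last by rewrite exprMn; lra.
by apply: lerXn2r; rewrite ?nnegrE ?mulr_ge0 //; nra.
Qed.

Lemma ln_ge_half n : (2 <= n)%N -> 1 / 2 <= ln (n%:R : R).
Proof.
move=> n2; have n0 : 0 < n%:R :> R by rewrite ltr0n; lia.
rewrite -(@expRK R (1 / 2)) ler_ln ?posrE ?expR_gt0 //.
apply: (@le_trans _ _ 2); last by rewrite (ler_nat _ 2).
have := @expR_ge1Dx R (- (1 / 2)); rewrite expRN => h.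
rewrite -[leLHS]invrK -[leRHS]invrK lef_pV2 ?posrE ?invr_gt0 ?expR_gt0 //; lra.
Qed.

Lemma adj_sym n (x : sample n) : (@adj R n x)^T = adj R x.
Proof.
apply/matrixP => i j; rewrite !mxE eq_sym; case: eqVneq => // ij.
case: (ltngtP i j) => // /val_inj e; by rewrite e eqxx in ij.
Qed.

Lemma adj_centered n r (sigma : 'I_n -> 'I_r) (p q : R) x :
  adj R x - expected_adj sigma p q = centered (edge_prob sigma p q) x.
Proof.
apply/matrixP => i j; rewrite !mxE; case: eqVneq => [_|ij]; first by rewrite subrr.
rewrite /edge; case: (ltnP i j) => //= _.
by rewrite /edge_prob eq_sym.
Qed.

End MainBounds.

(** * The recovery condition *)

Section RecoveryCondition.
Variables (R : realType) (n r K : nat) (p q C : R).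
Hypotheses (r_ge2 : (2 <= r)%N) (K_ge1 : (1 <= K)%N) (nE : n = (r * K)%N).
Hypotheses (q_ge0 : 0 <= q) (ltqp : q < p) (p_le1 : p <= 1) (C_ge0 : 0 <= C).
Hypothesis recovery :
  (12 + C) * Num.max (Num.sqrt (n%:R) / K%:R) (ln (n%:R) ^+ 2 / Num.sqrt (K%:R))
      <= (p - q) / Num.sqrt (p * (1 - q)).

Let s := Num.sqrt (p * (1 - q)).
Let v_gt0 : 0 < p * (1 - q). Proof. by move: q_ge0 ltqp p_le1 => *; apply: mulr_gt0; lra. Qed.
Let s_gt0 : 0 < s. Proof. by rewrite sqrtr_gt0. Qed.
Let s_sq : s ^+ 2 = p * (1 - q). Proof. by rewrite sqr_sqrtr // ltW. Qed.
Let n_ge2 : (2 <= n)%N.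
Proof. by rewrite nE (leq_trans r_ge2) // leq_pmulr. Qed.
Let n_gt0 : 0 < n%:R :> R. Proof. by rewrite ltr0n (leq_trans _ n_ge2). Qed.
Let K_gt0 : 0 < K%:R :> R. Proof. by rewrite ltr0n. Qed.

(** This is the first term of the maximum. With [C = 8 D] it yields eight times the noise level; the
    12 serves [recovery_K_ge2] and [recovery_log]. *)
Lemma recovery_size : (12 + C) * (Num.sqrt n%:R * s) <= (p - q) * K%:R.
Proof.
have h : (12 + C) * (Num.sqrt n%:R / K%:R) <= (p - q) / s.
  apply: le_trans recovery; rewrite ler_wpM2l ?addr_ge0 // le_max lexx //.
by move: h; rewrite ler_pdivlMr // mulrA mulrAC ler_pdivrMr // mulrA.
Qed.

Lemma recovery_K_ge2 : (2 <= K)%N.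
Proof.
have [h _] := separation_variance q_ge0 ltqp p_le1.
have ps : p - q <= s.
  rewrite -(@ler_pXn2r _ 2) ?nnegrE ?subr_ge0 ?(ltW ltqp) ?(ltW s_gt0) //.
  by rewrite s_sq.
have sn : 1 <= Num.sqrt n%:R :> R.
  by rewrite -[leLHS]sqrtr1 ler_wsqrtr // ler1n (leq_trans _ n_ge2).
have h1 := recovery_size; have h2 := ler_wpM2r (ltW K_gt0) ps.
have h3 : 12 * s <= s * K%:R.
  apply: le_trans h2; apply: le_trans h1.
  have h4 : 1 * s <= Num.sqrt n%:R * s by rewrite ler_wpM2r // ltW.
  have : 0 <= C * (Num.sqrt n%:R * s) by rewrite !mulr_ge0 // ltW.
  lra.
move: h3; rewrite mulrC ler_pM2l // => h3.
by rewrite -(ler_nat R); lra.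
Qed.

(** Squaring the second term of the maximum and using [(p - q)^2 <= 4 s^4] gives [36 l^4 <= s^2 K],
    where [s^2 K <= s^2 n / 2]; then [l >= 1/2] makes [72 l^4] at least [9 l]. The 9 exceeds 8 by
    one to absorb the factor [n] of the tail bound. *)
Lemma recovery_log : 9 * ln n%:R <= n%:R * (p * (1 - q)).
Proof.
have [_ h] := separation_variance q_ge0 ltqp p_le1.
set l := ln n%:R; have l2 : 1 / 2 <= l := ln_ge_half R n_ge2.
have sK : 0 < Num.sqrt K%:R :> R by rewrite sqrtr_gt0.
have h1 : 12 * (l ^+ 2 / Num.sqrt K%:R) <= (p - q) / s.
  apply: le_trans recovery.
  apply: (@le_trans _ _ (12 * Num.max (Num.sqrt n%:R / K%:R) (l ^+ 2 / Num.sqrt K%:R))).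
    by rewrite ler_wpM2l // le_max lexx orbT.
  by rewrite ler_wpM2r ?lerDl // le_max divr_ge0 ?sqrtr_ge0 // ltW.
have h2 : 12 * l ^+ 2 * s <= (p - q) * Num.sqrt K%:R.
  by move: h1; rewrite ler_pdivlMr // mulrA mulrAC ler_pdivrMr.
have h3 : 144 * l ^+ 4 * s ^+ 2 <= (p - q) ^+ 2 * K%:R.
  have -> : 144 * l ^+ 4 * s ^+ 2 = (12 * l ^+ 2 * s) ^+ 2 by ring.
  have -> : (p - q) ^+ 2 * K%:R = ((p - q) * Num.sqrt K%:R) ^+ 2.
    by rewrite exprMn sqr_sqrtr ?(ltW K_gt0).
  have pq : 0 <= p - q by rewrite subr_ge0 ltW.
  apply: lerXn2r; rewrite ?nnegrE //; apply: mulr_ge0 => //; try exact: ltW.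
  by apply: mulr_ge0; rewrite ?sqr_ge0.
have h4 : 144 * l ^+ 4 <= 4 * s ^+ 2 * K%:R.
  have s2 : 0 < s ^+ 2 by rewrite exprn_gt0.
  rewrite -(ler_pM2r s2); apply: le_trans h3 _.
  apply: (@le_trans _ _ (4 * (p * (1 - q)) ^+ 2 * K%:R)).
    by rewrite ler_wpM2r // ltW.
  by rewrite s_sq le_eqVlt; apply/orP; left; apply/eqP; ring.
have rR : 2 <= r%:R :> R by rewrite ler_nat.
have nR : n%:R = r%:R * K%:R :> R by rewrite nE natrM.
have h5 : 72 * l ^+ 4 <= n%:R * s ^+ 2.
  have s2K : 0 <= s ^+ 2 * K%:R by rewrite mulr_ge0 ?sqr_ge0 // ltW.
  have := ler_wpM2r s2K rR; rewrite nR; lra.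
rewrite -s_sq; apply: le_trans h5.
have l3 : 1 / 8 <= l ^+ 3.
  have l20 : 1 / 4 <= l ^+ 2 by rewrite expr2; nra.
  rewrite exprS; nra.
have l0 : 0 <= l by lra.
have := ler_wpM2l l0 l3; rewrite -exprS; lra.
Qed.

End RecoveryCondition.

(** * Choice of the absolute constants and conclusion *)

Lemma sqrt_scale_le (R : rcfType) (e d k x : R) : 0 <= e * d -> k <= 2 * x ->
  Num.sqrt (e * (d * k)) <= Num.sqrt (2 * (e * d)) * Num.sqrt x.
Proof.
move=> ed kx; rewrite -(sqrtrM _ (mulr_ge0 (ler0n R 2) ed)); apply: ler_wsqrtr.
by rewrite mulrA [2 * _]mulrC -[leRHS]mulrA ler_wpM2l.
Qed.

Theorem theorem3 (R : realType) :
  exists c0 c1 c4 : R, [/\ 0 < c0, 0 < c1, 0 < c4 &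
  forall (n r K : nat) (sigma : 'I_n -> 'I_r) (p q : R),
    (2 <= r)%N -> (1 <= K)%N -> n = (r * K)%N ->
    (forall k : 'I_r, #|[set i | sigma i == k]| = K) ->
    0 <= q -> q < p -> p <= 1 ->
    c1 * Num.max (Num.sqrt (n%:R) / K%:R) (ln (n%:R) ^+ 2 / Num.sqrt (K%:R))
      <= (p - q) / Num.sqrt (p * (1 - q)) ->
    1 - c0 * (n%:R) ^- 8 <= sbm_P sigma p q (success c4 K p q)].
Proof.
have eD0 : 0 < expR 1 * dense_const R by rewrite mulr_gt0 ?expR_gt0 ?dense_const_gt0.
have [D DE] : exists D, D = Num.sqrt (2 * (expR 1 * dense_const R)) by eexists.
have D0 : 0 < D by rewrite DE sqrtr_gt0 mulr_gt0.
(* [D] is the constant in [delta <= D sqrt (p (1 - q) n)]; [8 D] secures [8 delta <= (p - q) K],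
   [2 D] the error bound, and 6 comes from [norm_concentration]. *)
exists 6, (12 + 8 * D), (2 * D); split; [by []|lra|lra|].
move=> n r K sigma p q r2 K1 nE card_sigma q0 qp p1 rec.
have D8 : 0 <= 8 * D by lra.
have K2 := recovery_K_ge2 r2 K1 nE q0 qp p1 D8 rec.
have hsize := recovery_size K1 q0 qp p1 D8 rec.
have hlog := recovery_log r2 K1 nE q0 qp p1 D8 rec.
have n2 : (2 <= n)%N by rewrite nE (leq_trans r2) // leq_pmulr.
have nR : 0 < n%:R :> R by rewrite ltr0n (leq_trans _ n2).
have ln2 := ln_ge_half R n2.
set x := n%:R * (p * (1 - q)) in hlog.
have v1 : p * (1 - q) <= 1.
  by rewrite mulr_ile1 //; lra.
have xn : x <= n%:R by rewrite ler_piMr // ltW.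
have x1 : 1 <= x by lra.
have /andP[trl tru] : (Num.truncn x)%:R <= x < (Num.truncn x).+1%:R.
  by apply: truncn_itv; lra.
(* The truncation plus one exceeds [x = n p (1 - q)], so that [k / n] dominates every edge variance;
   the cap keeps [k <= n] and preserves [x <= k] since [x <= n]. *)
pose k := minn (Num.truncn x).+1 n.
have k0n : (0 < k <= n)%N by rewrite geq_minr leq_min /= (leq_trans _ n2).
have xk : x <= k%:R by rewrite /k; case: (leqP (Num.truncn x).+1 n) => _; rewrite ?(ltW tru).
have k2x : k%:R <= 2 * x.
  apply: (@le_trans _ _ (Num.truncn x).+1%:R); first by rewrite ler_nat geq_minl.
  by rewrite -natr1; lra.
have P01 i j : 0 <= edge_prob sigma p q i j <= 1.
  by rewrite /edge_prob; case: ifP => _; apply/andP; split; lra.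
have Pt i j : edge_prob sigma p q i j * (1 - edge_prob sigma p q i j) <= k%:R / n%:R.
  apply: (@le_trans _ _ (p * (1 - q))); last by rewrite ler_pdivlMr // mulrC.
  by rewrite /edge_prob; case: ifP => _; nra.
apply: le_trans (norm_concentration k0n P01 Pt _); last first.
  move=> y dev s spec rh rh_bnd rh_max.
  set delta := Num.sqrt _ in dev.
  have deltaE : delta <= D * Num.sqrt (p * (1 - q) * n%:R).
    by rewrite DE; apply: sqrt_scale_le; [exact: ltW|rewrite [_ * n%:R]mulrC].
  have sE : Num.sqrt (p * (1 - q) * n%:R) = Num.sqrt n%:R * Num.sqrt (p * (1 - q)) :> R.
    by rewrite -sqrtrM ?ler0n // mulrC.
  have sx0 : 0 <= Num.sqrt (p * (1 - q) * n%:R) :> R by apply: sqrtr_ge0.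
  apply: (@estimates R n r K sigma p q r2 K2 nE card_sigma q0 qp (adj R y) s delta) => //.
  - exact: adj_sym.
  - by move=> v; rewrite adj_centered.
  - by apply: le_trans hsize; rewrite -sE; lra.
  - by rewrite -(mulrA 2 D) ler_wpM2l.
rewrite lerD2l lerN2 -mulrA ler_wpM2l //.
(* In this form [9 ln n <= x <= k] suffices. *)
have -> : n%:R ^- 8 = n%:R * expR (- (9 * ln n%:R)) :> R.
  rewrite expRN -[9 * _]/(9%:R * _) expRM_natl lnK ?posrE //.
  by rewrite [n%:R ^+ 9]exprS (invfM n%:R (n%:R ^+ 8)) mulrA mulfV ?mul1r ?gt_eqF.
by rewrite ler_wpM2l ?ler_expR ?lerN2 ?(le_trans hlog) // ltW.
Qed.
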